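(* Let $K$ be an algebraically closed field of characteristic zero and $R=K[x,y,z]$. Let $I\subset R$ be an Artinian monomial ideal, generated by monomials of degree at most $d$. Assume $h_{R/I}(d-1)\le h_{R/I}(d)$ and that $R/I$ fails the weak Lefschetz property in degree $d-1$ by $\delta>0$. Then, for every reduction $\hat T=T_{d+1}(\hat I)$ of $T=T_{d+1}(I)$ to unit punctures such that the ideal $\hat I$ (generated by monomials of degree $d$) is Artinian, $\hat I$ defines a Togliatti system. Moreover, the variety $X_{2,[\hat I^{-1}]_d}$ satisfies $\delta$ Laplace equations of order $d-1$.
   Context: $h_{R/I}(j)=\dim_K[R/I]_j$. A graded algebra $A$ fails the weak Lefschetz property in degree $d-1$ by $\delta$ if, for a general linear form $\ell$, the rank of $\times\ell:[A]_{d-1}\to[A]_d$ is $\min\{h_A(d-1),h_A(d)\}-\delta$. Regions: for $e\ge1$, $\mathcal{T}_e$ is the equilateral triangle of side length $e$ subdivided into unit triangles, the downward-pointing ones labelled by the monomials of degree $e-2$ and the upward-pointing ones by the monomials of degree $e-1$ in $x,y,z$, with $x^{e-1}$ at the top, $y^{e-1}$ bottom-left, $z^{e-1}$ bottom-right; a downward triangle $n$ and an upward triangle $m$ share an edge iff $m\in\{xn,yn,zn\}$. $T_e(I)$ is the set of unit triangles whose label is not in $I$. Let $J(T)$ be the largest ideal generated by monomials of degree at most $e-1$ with $T=T_e(J(T))$; the punctures of $T$ correspond to the minimal generators $g$ of $J(T)$: the puncture of $g$ is the upward-pointing triangle of all unit triangles with labels divisible by $g$, of side length $e-\deg g$. Reduction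 to unit punctures of $T\subset\mathcal{T}_e$: suppose $T$ has a puncture of side length at least two. Let $i$ be the least $x$-exponent among the minimal generators of $J(T)$ of degree at most $e-2$, and consider the row of unit triangles whose labels have $x$-exponent $i$. In this row pick a maximal sequence $S$ of consecutively adjacent unit triangles none of which belongs to $T$, containing at least one downward-pointing triangle, and pick any upward-pointing unit triangle $P$ in $S$. Replace $T$ by $T\cup(S\setminus\{P\})$, again a triangular region. One may also use the same step with the role of $x$ interchanged with that of $y$ or $z$. A region $\hat T\supseteq T$ obtained by repeating such steps until all punctures have side length one is a reduction of $T$ to unit punctures. For $e=d+1$, $\hat T=T_{d+1}(\hat I)$ for a unique ideal $\hat I$ generated by monomials of degree $d$. Togliatti system: an Artinian ideal $\hat I\subset R$ minimally generated by $r\le d+1$ forms of degree $d$ defines a Togliatti system if it fails the weak Lefschetz property in degree $d-1$ (by some positive number). $\hat I^{-1}$ is the ideal generated by the Macaulay inverse system of $\hat I$; for monomial $\hat I$, $[\hat I^{-1}]_d$ is spanned by the monomials of degree $d$ not in $\hat I$. $X_{2,[\hat I^{-1}]_d}$ is the (closure of the) image of the rational map $\mathbb{P}^2\dashrightarrow\mathbb{P}^{\binom{d+2}{2}-r-1}$ given by these forms. Laplace equations: for an $n$-dimensional projective variety $X\subset\mathbb{P}^N$ and a smooth point $P\in X$ with local parametrisation $\varphi$ around $P$ (in affine coordinates, with formal power series components), the $s$-th osculating space $T_P^{(s)}X$ is the projectivised span of the partial derivatives of $\varphi$ of order at most $s$ at $P$. $X$ satisfies $\delta$ Laplace equations of order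 $s$ if $\dim T_P^{(s)}X=\binom{n+s}{s}-1-\delta$ for a general point $P\in X$. *)

(* Defs.v *)
From mathcomp Require Import all_boot all_order all_algebra.
From mathcomp Require Import boolp classical_sets.
From mathcomp Require Import mpoly.
From Stdlib Require Import Relation_Operators.

Set Implicit Arguments.
Unset Strict Implicit.
Unset Printing Implicit Defensive.

Import GRing.Theory.

Local Open Scope classical_set_scope.
Local Open Scope ring_scope.

(* The polynomial ring R = K[x,y,z] is {mpoly K[3]}; x, y, z are the variables
   of index 0, 1, 2 and x^a y^b z^c is identified with its exponent vector in
   'X_{1..3}. *)

Section Ideals.
Variables (n : nat) (K : fieldType).
Implicit Types (I J G : set {mpoly K[n]}).

Definition is_ideal I : Prop :=
  [/\ I 0, forall p q, I p -> I q -> I (p + q) & forall r p, I p -> I (r * p)].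

Definition ideal_gen G : set {mpoly K[n]} := smallest is_ideal G.

(* I is generated by monomials, all taken from D. *)
Definition monomial_ideal (D : set 'X_{1..n}) I : Prop :=
  exists2 M : set 'X_{1..n}, M `<=` D & I = ideal_gen [set 'X_[m] | m in M].

(* R/I is an Artinian ring: descending chain condition for the ideals
   containing I. *)
Definition artinian I : Prop :=
  forall J : nat -> set {mpoly K[n]},
    (forall k, is_ideal (J k)) -> (forall k, I `<=` J k) ->
    (forall k, J k.+1 `<=` J k) ->
  exists k0, forall k, (k0 <= k)%N -> J k = J k0.

Definition min_monomial_gens J : set 'X_{1..n} :=
  [set g | J 'X_[g] /\ forall h : 'X_{1..n}, J 'X_[h] -> (h <= g)%MM -> h = g].

Definition minimally_generated_by r (f : r.-tuple {mpoly K[n]}) I : Prop :=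
  I = ideal_gen [set` f] /\
  forall i : 'I_r, ~ ideal_gen [set tnth f k | k in [set k | k != i]] (tnth f i).

(* s is a K-basis of the image of the subspace V in R/I. *)
Definition basis_mod I (V : set {mpoly K[n]}) h (s : h.-tuple {mpoly K[n]}) :=
  [/\ forall i, V (tnth s i),
      forall c : 'I_h -> K,
        I (\sum_(i < h) c i *: tnth s i) -> forall i, c i = 0
    & forall p, V p -> exists c : 'I_h -> K,
        I (p - \sum_(i < h) c i *: tnth s i)].

(* The K-dimension of the image of V in R/I (when it is finite). *)
Definition dim_mod I (V : set {mpoly K[n]}) : nat :=
  xget 0%N [set h | exists s : h.-tuple {mpoly K[n]}, basis_mod I V s].

Definition forms j : set {mpoly K[n]} := [set p | p \is j.-homog].

Definition hilbert I j : nat := dim_mod I (forms j).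

(* The rank of multiplication by l from [R/I]_j to [R/I]_(j+1). *)
Definition mult_rank I (l : {mpoly K[n]}) j : nat :=
  dim_mod I [set l * p | p in forms j].

(* "For a general linear form": on a nonempty Zariski open set of coefficient
   vectors, which may be taken to be the complement of a hypersurface. *)
Definition for_general_linear_form (P : {mpoly K[n]} -> Prop) : Prop :=
  exists2 F : {mpoly K[n]}, F != 0 &
    forall a : 'I_n -> K, F.@[a] != 0 -> P (\sum_(i < n) a i *: 'X_i).

(* R/I fails the weak Lefschetz property in degree j by delta. *)
Definition fails_WLP I j delta : Prop :=
  for_general_linear_form (fun l =>
    mult_rank I l j + delta = minn (hilbert I j) (hilbert I j.+1))%N.

End Ideals.

Definition togliatti (K : fieldType) d (I : set {mpoly K[3]}) : Prop :=
  [/\ artinian I,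
      exists r (f : r.-tuple {mpoly K[3]}),
        [/\ (r <= d.+1)%N, forall i, tnth f i \is d.-homog
          & minimally_generated_by f I]
    & exists2 delta, (0 < delta)%N & fails_WLP I d.-1 delta].

Section TriangularRegions.
Variables (K : fieldType) (e : nat).
Implicit Types (T : set 'X_{1..3}) (J : set {mpoly K[3]}) (m g : 'X_{1..3}).

(* A unit triangle of T_e is identified with its label.  The successor form of
   the degree conditions avoids truncated subtraction when e = 1. *)
Definition upward m : bool := ((mdeg m).+1 == e)%N.
Definition downward m : bool := ((mdeg m).+2 == e)%N.

Definition region J : set 'X_{1..3} :=
  [set m | (upward m || downward m) /\ ~ J 'X_[m]].

(* J = J(T) *)
Definition is_region_ideal T J : Prop :=
  let presents J' := monomial_ideal [set m | (mdeg m < e)%N] J' /\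
                     T = region J' in
  presents J /\ forall J', presents J' -> J' `<=` J.

(* A puncture is represented by its generator g. *)
Definition punctures T : set 'X_{1..3} :=
  [set g | exists2 J, is_region_ideal T J & min_monomial_gens J g].

Definition side_length g : nat := (e - mdeg g)%N.

Definition unit_punctures T : Prop :=
  forall g, punctures T g -> side_length g = 1%N.

(* m1 and m2 share an edge: one is a variable times the other. *)
Definition adjacent : rel 'X_{1..3} := fun m1 m2 =>
  [exists j : 'I_3, (m1 == (U_(j) + m2)%MM) || (m2 == (U_(j) + m1)%MM)].

(* s is a sequence of consecutively adjacent unit triangles outside T, in the
   row where the exponent of the v-th variable is i. *)
Definition is_gap T (v : 'I_3) (i : nat) (s : seq 'X_{1..3}) : Prop :=
  [/\ forall m, m \in s -> [/\ upward m || downward m, m v = i & ~ T m],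
      uniq s & sorted adjacent s].

Definition is_max_gap T v i s : Prop :=
  is_gap T v i s /\
  forall s', is_gap T v i s' -> {subset s <= s'} -> {subset s' <= s}.

Definition reduction_step T T' : Prop :=
  exists (v : 'I_3) (i : nat) (s : seq 'X_{1..3}) (P : 'X_{1..3}),
  [/\ exists g, [/\ punctures T g, (2 <= side_length g)%N & g v = i],
      forall g, punctures T g -> (2 <= side_length g)%N -> (i <= g v)%N,
      is_max_gap T v i s /\ has downward s,
      P \in s /\ upward P
    & T' = T `|` ([set` s] `\ P)].

Definition reduction_to_unit_punctures T T' : Prop :=
  clos_refl_trans _ reduction_step T T' /\ unit_punctures T'.

End TriangularRegions.

(* A subset of P^(N-1) is given by the set of all homogeneous coordinate vectors
   of its points. *)
Section ProjectiveVarieties.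
Variables (K : fieldType) (N : nat).
Implicit Types (X : set ('I_N -> K)) (P : 'I_N -> K) (F : {mpoly K[N]}).

Definition vanishing_forms X : set {mpoly K[N]} :=
  [set F | (exists k, F \is k.-homog) /\ forall P, X P -> F.@[P] = 0].

Definition proj_closure X : set ('I_N -> K) :=
  [set P | (exists j, P j != 0) /\ forall F, vanishing_forms X F -> F.@[P] = 0].

(* The coordinates w_j, j in A, are algebraically independent in the
   homogeneous coordinate ring of X. *)
Definition alg_independent X (A : {set 'I_N}) : Prop :=
  forall F, (forall m, m \in msupp F -> forall j, j \notin A -> m j = 0%N) ->
    vanishing_forms X F -> F = 0.

(* dim X = n: the homogeneous coordinate ring of X, generated by the w_j, has
   transcendence degree n + 1. *)
Definition proj_dim X n : Prop :=
  (exists2 A, alg_independent X A & #|A| = n.+1) /\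
  forall A, alg_independent X A -> (#|A| <= n.+1)%N.

(* For X of dimension n, P is smooth iff the embedded tangent space at P has
   projective dimension n; the rows of B are a basis of the corresponding
   linear subspace of K^N. *)
Definition smooth_point X n P : Prop :=
  X P /\ exists2 B : 'M[K]_(n.+1, N), row_free B &
    forall u : 'rV[K]_N, (u <= B)%MS <->
      (forall F, vanishing_forms X F ->
         \sum_(j < N) (F^`M(j)).@[P] * u 0 j = 0).

(* Vectors of N formal power series in n variables: phi j a is the coefficient
   of t^a in the j-th component. *)
Definition fps_vector n := 'I_N -> 'X_{1..n} -> K.

Definition fps_trunc n (phi : fps_vector n) k : N.-tuple {mpoly K[n]} :=
  [tuple \sum_(a : 'X_{1..n < k.+1}) phi j a *: 'X_[a] | j < N].

(* F(phi) = 0 in K[[t]]; the coefficient of t^a in F(phi) only depends on the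
   coefficients of phi up to degree |a|. *)
Definition fps_zero n F (phi : fps_vector n) : Prop :=
  forall a : 'X_{1..n}, (F \mPo fps_trunc phi (mdeg a))@_a = 0.

(* The vector of partial derivatives of order a of phi at t = 0. *)
Definition fps_deriv n (phi : fps_vector n) (a : 'X_{1..n}) : 'rV[K]_N :=
  \row_(j < N) ((\prod_(i < n) (a i)`!)%:R * phi j a).

(* phi parametrises X locally around P, in the affine coordinates of the chart
   w_c = 1: it is centred at P, it satisfies the equations of X, and its
   Jacobian matrix at t = 0 has rank n.  At a smooth point of an n-dimensional X
   this means that phi induces an isomorphism from the completed local ring of X
   at P to K[[t_1, ..., t_n]]. *)
Definition local_param X n P (phi : fps_vector n) : Prop :=
  [/\ exists c : 'I_N,
        [/\ P c != 0, forall a, phi c a = (a == 0%MM)%:R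
          & forall j, phi j 0%MM = P j / P c],
      forall F, vanishing_forms X F -> fps_zero F phi
    & row_free (\matrix_(i < n, j < N) fps_deriv phi U_(i)%MM 0 j)].

(* The s-th osculating space of X at P has projective dimension k.  In the
   homogeneous coordinates of the chart used by phi the derivative of order 0
   is a coordinate vector of P, and those of positive order have c-th entry 0. *)
Definition osculating_dim X n P (s k : nat) : Prop :=
  exists2 phi : fps_vector n, local_param X P phi &
    \dim <<[seq fps_deriv phi (bmnm a) | a : 'X_{1..n < s.+1}]>>%VS = k.+1.

(* "For a general point of X": on a nonempty open subset of X. *)
Definition for_general_point X (Q : ('I_N -> K) -> Prop) : Prop :=
  exists G : {mpoly K[N]},
  [/\ exists k, G \is k.-homog, exists2 P, X P & G.@[P] != 0
    & forall P, X P -> G.@[P] != 0 -> Q P].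

(* X satisfies delta Laplace equations of order s:
   dim T_P^(s) X = binom(n + s, s) - 1 - delta with n = dim X. *)
Definition laplace_equations X (s delta : nat) : Prop :=
  exists2 n, proj_dim X n &
    for_general_point X (fun P => smooth_point X n P /\
      exists2 k, osculating_dim X n P s k & (k + 1 + delta)%N = 'C(n + s, s)).

Definition image_closure (f : N.-tuple {mpoly K[3]}) : set ('I_N -> K) :=
  proj_closure [set P | (exists j, P j != 0) /\
                   exists p : 'I_3 -> K, P = fun j => (tnth f j).@[p]].

End ProjectiveVarieties.

(* The monomials of degree d not in I, which for a monomial ideal I form a basis
   of the degree d part of its Macaulay inverse system. *)
Definition inverse_system_monomials (K : fieldType) (I : set {mpoly K[3]}) d :
    seq {mpoly K[3]} :=
  [seq 'X_[bmnm m] | m <- enum {: 'X_{1..3 < d.+1}}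
     & (mdeg (bmnm m) == d) && ~~ `[< I 'X_[bmnm m] >]].

(* The variety X_{2,[I^-1]_d} *)
Definition inverse_system_variety (K : fieldType) (I : set {mpoly K[3]}) d :=
  image_closure (in_tuple (inverse_system_monomials I d)).

Arguments inverse_system_variety {K} I d _.

(* Main.v *)
Require Import Defs.
From mathcomp Require Import all_boot all_order all_algebra.
From mathcomp Require Import boolp classical_sets.
From mathcomp Require Import mpoly.
From mathcomp Require Import ring zify.

(* Multiplication by a linear form a_0 x + a_1 y + a_2 z on a monomial quotient is,
   in the monomial bases, the incidence matrix of downward and upward triangles of
   the region, with entries a_v.  Rescaling rows and columns by monomials in a shows
   that its rank is the same for all a with nonzero entries.

   Reduction: filling a gap from either end towards P adds a downward and an upward
   triangle at a time, in such a way that the row of the downward triangle has the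
   new column as its only nonzero entry.  Rank and both dimensions grow by one, so
   the defect delta and the inequality of the dimensions survive; since all downward
   triangles are present at the end, the inequality bounds the number of generators
   by d + 1.

   Laplace equations: X is a toric variety.  At a point P with nonzero coordinates
   the binomials vanishing on X and the torus action determine the tangent space, and
   the orbit map is a local parametrisation.  Its derivatives of order at most d - 1
   are, up to the factors P_j / P_c, falling factorials of the exponents m_j - m_c;
   they span the polynomials of degree at most d - 1 in the exponents, hence also the
   products (m_j)_b = prod_v (m_j v)_(b v) with |b| = d - 1.  Such a product vanishes
   unless m_j = x_v b for some v, when it equals m_j!; so these rows form the incidence
   matrix up to column scaling. *)

Set Implicit Arguments.
Unset Strict Implicit.
Unset Printing Implicit Defensive.

Import GRing.Theory Num.Theory Order.TTheory.

Local Open Scope classical_set_scope.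
Local Open Scope ring_scope.

(** * Preliminaries on polynomials and monomial ideals *)

Lemma pchar0_natr_neq0 (R : idomainType) n :
  [pchar R] =i pred0 -> (0 < n)%N -> n%:R != 0 :> R.
Proof. by move=> charR; have /pcharf0P -> := charR; rewrite lt0n. Qed.

Lemma pchar0_natr_inj (R : idomainType) : [pchar R] =i pred0 ->
  injective (fun n => n%:R : R).
Proof.
move=> charR m n; wlog le_mn : m n / (m <= n)%N => [hw|].
  by case/orP: (leq_total m n) => [/hw//|/hw h /esym/h].
move=> eq_mn; apply/eqP; rewrite eqn_leq le_mn /= leqNgt; apply/negP => lt_mn.
have := pchar0_natr_neq0 charR (n := n - m); rewrite subn_gt0 => /(_ lt_mn).
by rewrite natrB // eq_mn subrr eqxx.
Qed.

Lemma pchar0_intr_neq0 (R : idomainType) (z : int) :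
  [pchar R] =i pred0 -> z != 0 -> z%:~R != 0 :> R.
Proof.
move=> charR; case: z => n nz; last by rewrite NegzE rmorphN oppr_eq0 pchar0_natr_neq0.
by rewrite -pmulrn pchar0_natr_neq0 // lt0n.
Qed.

(** Uniqueness of base [B] digits, by reduction modulo [B]; it makes the Kronecker substitution
    below injective on exponents. *)
Lemma digits_inj n (B : nat) (f g : 'I_n -> nat) :
    (forall i, f i < B)%N -> (forall i, g i < B)%N ->
  (\sum_i f i * B ^ i = \sum_i g i * B ^ i)%N -> f =1 g.
Proof.
elim: n f g => [|n IHn] f g ltf ltg; first by move=> _ [].
have shift (h : 'I_n.+1 -> nat) : (\sum_i h i * B ^ i =
    h ord0 + B * \sum_(i < n) h (lift ord0 i) * B ^ i)%N.
  rewrite big_ord_recl expn0 muln1; congr addn; rewrite big_distrr /=.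
  by apply: eq_bigr => i _; rewrite expnS; ring.
rewrite !shift => eq_fg.
have B0 : (0 < B)%N by apply: leq_ltn_trans (ltf ord0).
have eq0 : f ord0 = g ord0.
  by move/(congr1 (modn^~ B)): eq_fg; rewrite ![(B * _)%N]mulnC
     ![(_ + _ * B)%N]addnC !modnMDl !modn_small.
have eqS : (fun i => f (lift ord0 i)) =1 (fun i => g (lift ord0 i)).
  apply: IHn => //.
  by move: eq_fg; rewrite eq0 => /addnI/eqP; rewrite eqn_pmul2l // => /eqP.
by move=> i; case: (unliftP ord0 i) => [j ->|->].
Qed.

Lemma mcoeffMXE (R : nzRingType) n (p : {mpoly R[n]}) m k :
  (p * 'X_[m])@_k = if (m <= k)%MM then p@_(k - m) else 0.
Proof.
case: ifPn => [le_mk|/negP nle]; first by rewrite -{1}(submK le_mk) addmC mcoeffMX.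
apply/eqP; rewrite mcoeff_eq0 (perm_mem (msuppMX p m)).
by apply/mapP => -[m' _ eq_k]; case: nle; rewrite eq_k lem_addr.
Qed.

(* Kronecker substitution of powers of a single t, for t among the integers. *)
Lemma mpoly_nonvanishing (K : fieldType) n (F : {mpoly K[n]}) :
  [pchar K] =i pred0 -> F != 0 -> exists a : 'I_n -> K, F.@[a] != 0.
Proof.
move=> charK F0; set B := msize F.
pose w (m : 'X_{1..n}) := (\sum_i m i * B ^ i)%N.
pose p : {poly K} := \sum_(m <- msupp F) F@_m *: 'X^(w m).
have ltB m : m \in msupp F -> forall i, (m i < B)%N.
  move=> /msize_mdeg_lt; rewrite mdegE => lt_mB i.
  by apply: leq_ltn_trans lt_mB; rewrite (bigD1 i) //= leq_addr.
have p0 : p != 0.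
  have m0s := mlead_supp F0; set m0 := mlead F in m0s.
  apply/eqP => /polyP/(_ (w m0)); rewrite coef0 coef_sum.
  rewrite (bigD1_seq m0) ?msupp_uniq //= coefZ coefXn eqxx mulr1 big1_seq.
    by rewrite addr0 => /eqP; rewrite mcoeff_eq0 m0s.
  move=> m /andP[nem ms]; rewrite coefZ coefXn; case: eqP => [eqw|]; last first.
    by rewrite mulr0.
  case/negP: nem; apply/eqP/mnmP.
  by apply: (@digits_inj n B) => //; exact: ltB.
(* In characteristic zero the images of 0, 1, 2, ... are distinct, too many to be roots of [p]. *)
have [t rt] : exists t, ~~ root p t.
  apply: contrapT => nrt; have rootp t : root p t.
    by apply: contrapT => /negP rt; apply: nrt; exists t.
  have := max_poly_roots (rs := [seq i%:R | i <- iota 0 (size p)]) p0.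
  rewrite size_map size_iota ltnn map_inj_uniq ?iota_uniq; last first.
    exact: pchar0_natr_inj.
  suff -> : all (root p) [seq i%:R | i <- iota 0 (size p)] by move/(_ isT isT).
  by apply/allP.
exists (fun i : 'I_n => t ^+ (B ^ i)%N); rewrite mevalE.
suff <- : p.[t] = \sum_(m <- msupp F) F@_m * \prod_(i < n) (t ^+ (B ^ i)%N) ^+ m i.
  by [].
rewrite horner_sum; apply: eq_bigr => m _; rewrite hornerZ hornerXn; congr *%R.
by rewrite /w expr_sum; apply: eq_bigr => j _; rewrite -exprM mulnC.
Qed.

Section Dimension.
Variables (n : nat) (K : fieldType).
Implicit Types (I V : set {mpoly K[n]}).

Definition is_subspace I := [/\ I 0, forall p q, I p -> I q -> I (p + q)
  & forall c p, I p -> I (c *: p)].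

Lemma ideal_subspace I : is_ideal I -> is_subspace I.
Proof.
by case=> I0 ID IM; split=> // c p Ip; rewrite -mul_mpolyC; exact: IM.
Qed.

Lemma subspace_sum I (T : Type) (r : seq T) (P : pred T) F : is_subspace I ->
  (forall i, P i -> I (F i)) -> I (\sum_(i <- r | P i) F i).
Proof. by case=> I0 ID _ IF; elim/big_ind: _. Qed.

(** A relation among the rows of the coordinate matrix of [s'] with respect to [s] would be a
    relation of [s'] modulo [I]; so this matrix is row free. *)
Lemma leq_basis_mod I V h h' (s : h.-tuple {mpoly K[n]}) (s' : h'.-tuple _) :
  is_subspace I -> basis_mod I V s -> basis_mod I V s' -> (h' <= h)%N.
Proof.
move=> sI [_ _ spn] [Vs' free' _].
have ID := let: And3 _ h _ := sI in h; have IZ := let: And3 _ _ h := sI in h.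
have /choice[A HA] : forall i : 'I_h', exists c : 'I_h -> K,
  I (tnth s' i - \sum_(j < h) c j *: tnth s j) by move=> i; exact: spn.
pose M := \matrix_(i < h', j < h) A i j.
suff rf : row_free M by rewrite -(eqP rf) rank_leq_col.
rewrite -kermx_eq0; apply/rowV0P => u /sub_kermxP uM0; apply/rowP => i.
rewrite mxE; apply: (free' (fun i => u 0 i)).
suff -> : \sum_i u 0 i *: tnth s' i =
    \sum_i u 0 i *: (tnth s' i - \sum_j A i j *: tnth s j).
  by apply: subspace_sum => // k _; exact: IZ.
under [RHS]eq_bigr do rewrite scalerBr.
rewrite sumrB [X in _ = _ - X](_ : _ = 0) ?subr0 //.
under eq_bigr do rewrite scaler_sumr.
rewrite exchange_big big1 // => j _ /=.
under eq_bigr do rewrite scalerA.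
rewrite -scaler_suml; move/rowP/(_ j): uM0; rewrite !mxE.
by under eq_bigr do rewrite mxE; move=> ->; rewrite scale0r.
Qed.

Lemma dim_modE I V h (s : h.-tuple {mpoly K[n]}) : is_subspace I ->
  basis_mod I V s -> dim_mod I V = h.
Proof.
move=> sI bs; rewrite /dim_mod; case: xgetP => [h' -> [s' bs']|/(_ h)[]].
  by apply/eqP; rewrite eqn_leq (leq_basis_mod sI bs bs') (leq_basis_mod sI bs' bs).
by exists s.
Qed.

End Dimension.

Section MonomialIdeals.
Variables (n : nat) (K : fieldType).
Implicit Types (I J G : set {mpoly K[n]}) (D M : set 'X_{1..n}).

(** Monomial ideals without reference to generators, so that ideals generated in degrees at most [d]
    and exactly [d] are treated alike. *)
Definition monomially_spanned I :=
  is_ideal I /\ forall p, I p -> forall m, m \in msupp p -> I 'X_[m].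

Lemma ideal_genP G : is_ideal (ideal_gen G).
Proof.
split=> [J [[]]//|p q Ip Iq J JG|r p Ip J JG].
  by case: (JG) => -[_ JD _] _; apply: JD; [exact: Ip|exact: Iq].
by case: (JG) => -[_ _ JM] _; apply: JM; exact: Ip.
Qed.

Lemma sub_ideal_gen G : G `<=` ideal_gen G.
Proof. by move=> p Gp J [_]; exact. Qed.

Lemma ideal_gen_sub G J : is_ideal J -> G `<=` J -> ideal_gen G `<=` J.
Proof. by move=> idJ GJ p; exact. Qed.

Lemma ideal_gen_monomialsE M : ideal_gen [set 'X_[K, m] | m in M] =
  [set p | forall m, m \in msupp p -> exists2 g, M g & (g <= m)%MM].
Proof.
apply/seteqP; split=> [p|p /= Mp].
  apply; split; last first.
    by move=> _ [g Mg <-] m /mem_msuppXP <-; exists g => //; exact: lepm_refl.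
  split=> [m|q r Mq Mr m|r q Mq m]; first by rewrite msupp0.
    by move=> /msuppD_le; rewrite mem_cat => /orP[/Mq|/Mr].
  move/msuppM_le/allpairsP => [[m1 m2] /= [_ /Mq[g Mg le_g] ->]].
  exists g => //; apply/mnm_lepP => i; rewrite mnmDE.
  by apply: leq_trans (leq_addl _ _); exact/mnm_lepP.
rewrite [p]mpolyE big_seq; have sI := ideal_subspace (ideal_genP [set 'X_[m] | m in M]).
apply: subspace_sum => // m /Mp[g Mg le_gm].
rewrite -[m](submK le_gm) mpolyXD -mul_mpolyC mulrA.
by case: (ideal_genP [set 'X_[m] | m in M]) => _ _; apply; apply: sub_ideal_gen; exists g.
Qed.

Lemma monomial_idealP D I : monomial_ideal D I ->
  exists2 M, M `<=` D & I = [set p | forall m, m \in msupp p ->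
                                     exists2 g, M g & (g <= m)%MM].
Proof. by case=> M MD ->; exists M => //; rewrite ideal_gen_monomialsE. Qed.

Lemma monomial_ideal_spanned D I : monomial_ideal D I -> monomially_spanned I.
Proof.
move=> mI; split; first by case: mI => M _ ->; exact: ideal_genP.
case: (monomial_idealP mI) => M _ -> p /= Ip m /Ip[g Mg gm] _ /mem_msuppXP <-.
by exists g.
Qed.

Lemma monomially_spannedP I p : monomially_spanned I ->
  (forall m, m \in msupp p -> I 'X_[m]) -> I p.
Proof.
case=> /ideal_subspace sI _ Ip; rewrite [p]mpolyE big_seq.
by apply: subspace_sum => // m /Ip; case: sI => _ _; exact.
Qed.

Lemma spanned_lepm I m m' : monomially_spanned I -> (m <= m')%MM ->
  I 'X_[m] -> I 'X_[m'].
Proof.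
by move=> [[_ _ IM] _] le_mm Im; rewrite -(submK le_mm) mpolyXD; exact: IM.
Qed.

(** The chain I + (x_v^k) becomes stationary, which forces some x_v^k into [I]. A generator dividing
    it is again a power of x_v, of degree at most [d]. *)
Lemma artinian_pure_power D I (v : 'I_n) d : monomial_ideal D I ->
  D `<=` [set m | (mdeg m <= d)%N] -> artinian I -> I 'X_[(U_(v) *+ d)%MM].
Proof.
move=> mI Dd; have spI := monomial_ideal_spanned mI; have [idI _] := spI.
pose J k := [set p | exists2 q, I q & exists r, p = q + r * 'X_v ^+ k].
move=> /(_ J)[].
- move=> k; case: idI => I0 ID IM; split.
  + by exists 0 => //; exists 0; rewrite mul0r addr0.
  + move=> _ _ [q Iq [r ->]] [q' Iq' [r' ->]]; exists (q + q'); first exact: ID.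
    by exists (r + r'); ring.
  + move=> a _ [q Iq [r ->]]; exists (a * q); first exact: IM.
    by exists (a * r); ring.
- by move=> k p Ip; exists p => //; exists 0; rewrite mul0r addr0.
- by move=> k _ [q Iq [r ->]]; exists q => //; exists (r * 'X_v); rewrite exprS; ring.
move=> k /(_ k.+1 (leqnSn k)) eqJ.
have : J k ('X_v ^+ k).
  by exists 0; [case: idI | exists 1; rewrite mul1r add0r].
rewrite -eqJ => -[q Iq [r eq_q]].
have Ik : I 'X_[(U_(v) *+ k)%MM].
  case: spI => _; apply; first exact: Iq.
  have -> : q = 'X_v ^+ k - r * 'X_v ^+ k.+1 by rewrite eq_q; ring.
  (* Multiples of x_v^(k+1) have no term x_v^k, so the coefficient here is 1. *)
  rewrite mcoeff_msupp mcoeffB !mpolyXn mcoeffX eqxx mcoeffMXE.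
  case: ifP => [/mnm_lepP/(_ v)|_]; last by rewrite subr0 oner_eq0.
  by rewrite !mulmnE mnm1E eqxx !mul1n ltnn.
case: (monomial_idealP mI) Ik => M MD -> /(_ (U_(v) *+ k)%MM).
case=> [|g Mg /mnm_lepP le_gk]; first by apply/mem_msuppXP.
move=> _ /mem_msuppXP <-; exists g => //; apply/mnm_lepP => i.
have /Dd/= := MD _ Mg; rewrite mdegE (bigD1 i) //= mulmnE mnm1E => le_gd.
have := le_gk i; rewrite mulmnE mnm1E; case: eqP => _; last by rewrite !mul0n.
by rewrite !mul1n => _; apply: leq_trans le_gd; rewrite leq_addr.
Qed.

End MonomialIdeals.

(** * Hilbert function and ranks of multiplication maps *)

(** The monomials of degree [j] outside [I] form a basis; bounding them by [d] lets the degrees d -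
    1 and d share one finite index type. *)
Lemma hilbertE n (K : fieldType) d (I : set {mpoly K[n]}) j :
    monomially_spanned I -> (j <= d)%N ->
  hilbert I j =
    #|[pred b : 'X_{1..n < d.+1} | (mdeg b == j) && ~~ `[< I 'X_[b] >]]|.
Proof.
move=> spI le_jd; set A := [pred b | _].
pose s := [tuple 'X_[K, bmnm (enum_val i)] | i < #|A|].
have tnth_s i : tnth s i = 'X_[bmnm (enum_val i)] by rewrite tnth_mktuple.
have coef_sum (c : 'I_#|A| -> K) i :
    (\sum_(k < #|A|) c k *: tnth s k)@_(bmnm (enum_val i)) = c i.
  rewrite raddf_sum (bigD1 i) //= tnth_s mcoeffZ mcoeffX eqxx mulr1 big1 ?addr0//.
  move=> k /negbTE nek; rewrite tnth_s mcoeffZ mcoeffX.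
  by rewrite -bmeqP (inj_eq enum_val_inj) nek mulr0.
have AP (i : 'I_#|A|) : (mdeg (bmnm (enum_val i)) == j) /\ ~ I 'X_[bmnm (enum_val i)].
  by have /andP[? /asboolPn] := enum_valP i.
apply: (dim_modE (s := s)); first exact: ideal_subspace (proj1 spI).
split=> [i|c Ic i|p pj].
- by rewrite /forms /= tnth_s dhomogX; case: (AP i).
- apply: contrapT => /eqP ci; case: (AP i) => _; apply.
  by case: spI => _ /(_ _ Ic); apply; rewrite mcoeff_msupp coef_sum.
exists (fun i => p@_(bmnm (enum_val i))); apply: monomially_spannedP => // m.
rewrite mcoeff_msupp => nz; apply: contrapT => nIm; case/negP: nz.
have [dm|dm] := eqVneq (mdeg m) j; last first.
  rewrite mcoeffB (dhomog_nemf_coeff pj dm) sub0r oppr_eq0 raddf_sum big1 //=.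
  move=> i _; rewrite tnth_s mcoeffZ mcoeffX; case: eqP => [eqm|]; last first.
    by rewrite mulr0.
  by case/negP: dm; rewrite -eqm; case: (AP i).
have dm' : (mdeg m < d.+1)%N by rewrite dm ltnS.
have mA : BMultinom dm' \in A.
  by rewrite inE /= dm eqxx; apply/asboolPn.
have -> : m = bmnm (enum_val (enum_rank_in mA (BMultinom dm'))) by rewrite enum_rankK_in.
by rewrite mcoeffB coef_sum subrr.
Qed.

Section LefschetzMatrix.
Variables (K : fieldType) (d : nat).
Implicit Types (T : set 'X_{1..3}) (a : 'I_3 -> K) (I : set {mpoly K[3]}).

Local Notation B := 'X_{1..3 < d.+1}.
Local Notation q := #|{: B}|.
Local Notation down := (downward d.+1).
Local Notation up := (upward d.+1).

Definition label (i : 'I_q) : 'X_{1..3} := bmnm (enum_val i : B).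

Lemma label_inj : injective label.
Proof. by move=> i j /val_inj/enum_val_inj. Qed.

Lemma labelP m : (mdeg m <= d)%N -> exists i, label i = m.
Proof.
rewrite -ltnS => dm; exists (enum_rank (BMultinom dm : B)).
by rewrite /label enum_rankK.
Qed.

Lemma upP m : up m = (mdeg m == d). Proof. by rewrite /upward eqSS. Qed.

Lemma downP m : down m = ((mdeg m).+1 == d). Proof. by rewrite /downward eqSS. Qed.

Lemma up_addU v n : up (U_(v) + n)%MM = down n.
Proof. by rewrite upP downP mdegD mdeg1. Qed.

Lemma down_upF n : down n -> up n = false.
Proof. by rewrite upP downP => /eqP <-; apply/eqP/n_Sn. Qed.

Lemma up_labelP m : up m -> exists i, label i = m.
Proof. by rewrite upP => /eqP dm; apply: labelP; rewrite dm. Qed.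

Lemma down_labelP m : down m -> exists i, label i = m.
Proof. by rewrite downP => dm; apply: labelP; apply: ltnW; rewrite (eqP dm). Qed.

(* Rows and columns run over all monomials of degree at most d; the entries outside
   downward and upward triangles of T are padded with zeros. *)
Definition lefschetz_mx T a : 'M[K]_q := \matrix_(i, j)
  if `[< [/\ down (label i), up (label j), T (label i) & T (label j)] >]
  then \sum_v a v *+ (label j == U_(v) + label i)%MM else 0.

(** A divisor of a label outside an ideal is outside it too. Hence the coefficient of a product at a
    label in [T] only receives contributions from labels in [T], and the padding of the matrix loses
    nothing. *)
Definition up_closed T := forall n v, down n -> T (U_(v) + n)%MM -> T n.

Lemma region_up_closed I : is_ideal I -> up_closed (region d.+1 I).
Proof.
move=> [_ _ IM] n v dn [_ nI]; split; first by rewrite dn orbT.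
by apply: contra_not nI => In; rewrite mpolyXD; exact: IM.
Qed.

Definition coef_row (p : {mpoly K[3]}) : 'rV[K]_q := \row_i p@_(label i).

Definition linear_form a : {mpoly K[3]} := \sum_v a v *: 'X_v.

Lemma coef_row_mul T a p j : up_closed T -> up (label j) -> T (label j) ->
  (linear_form a * p)@_(label j) = (coef_row p *m lefschetz_mx T a) 0 j.
Proof.
move=> clT uj Tj; rewrite mxE.
transitivity (\sum_(v < 3) \sum_i p@_(label i) *
    (a v *+ (label j == U_(v) + label i)%MM)).
  rewrite mulr_suml raddf_sum /=; apply: eq_bigr => v _.
  rewrite -scalerAl mulrC mcoeffZ mcoeffMXE; case: ifPn => le_vj.
    have [i Di] : exists i, label i = (label j - U_(v))%MM.
      apply: labelP; apply: leq_trans (mdegB _ _) _.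
      by move: uj; rewrite upP => /eqP->.
    rewrite (bigD1 i) //= Di addmC submK // eqxx big1 ?addr0; first by rewrite mulrC.
    move=> k nek; case: eqP => [eqj|]; last by rewrite mulr0.
    by case/eqP: nek; apply: label_inj; rewrite Di eqj addmC addmK.
  rewrite mulr0 big1 // => i _; case: eqP => [eqj|]; last by rewrite mulr0.
  by case/negP: le_vj; rewrite eqj lem_addr.
rewrite exchange_big /=; apply: eq_bigr => i _; rewrite !mxE -mulr_sumr.
case: asboolP => // nc; congr *%R; apply: big1 => v _.
case: eqP => // eqj; case: nc; rewrite uj.
have di : down (label i) by rewrite -(up_addU v) -eqj.
by split=> //; apply: (clT _ v) => //; rewrite -eqj.
Qed.

Lemma mult_image0 I a p : monomially_spanned I -> (0 < d)%N ->
    p \is d.-1.-homog ->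
  I (linear_form a * p) <-> coef_row p *m lefschetz_mx (region d.+1 I) a = 0.
Proof.
move=> spI d0 ph; have clI := region_up_closed (proj1 spI).
split=> [Ip|Z0].
  apply/rowP => j; rewrite [RHS]mxE.
  case: (pselect (up (label j) /\ region d.+1 I (label j))) => [[uj Tj]|nj].
    rewrite -coef_row_mul //; apply/eqP; rewrite mcoeff_eq0; apply/negP => sj.
    case: Tj => _; apply; exact: (proj2 spI _ Ip _ sj).
  rewrite mxE big1 // => i _; rewrite [lefschetz_mx _ _ _ _]mxE.
  by case: asboolP => [[_ uj _ Tj]|]; [case: nj | rewrite mulr0].
apply: monomially_spannedP => // m; rewrite mcoeff_msupp => nz.
apply: contrapT => nIm; case/negP: nz.
have [dm|dm] := boolP (up m).
  have [j Dj] := up_labelP dm; have Tj : region d.+1 I (label j).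
    by rewrite Dj; split=> //; rewrite dm.
  by rewrite -Dj (coef_row_mul _ _ clI) ?Z0 ?mxE // Dj.
have lh : linear_form a \is 1.-homog.
  apply: rpred_sum => v _; apply: dhomogZ; rewrite dhomogX; exact/eqP/mdeg1.
by have := dhomogM lh ph; rewrite add1n prednK // => /dhomog_nemf_coeff ->.
Qed.

Lemma mult_rankE I a : monomially_spanned I -> (0 < d)%N ->
  mult_rank I (linear_form a) d.-1 = \rank (lefschetz_mx (region d.+1 I) a).
Proof.
move=> spI d0; set Z := lefschetz_mx _ a; set r := \rank Z.
have sI := ideal_subspace (proj1 spI).
have /submxP[D DZ] : (row_base Z <= Z)%MS by rewrite eq_row_base.
(* Rows of [Z] off the downward triangles vanish, so dropping their coefficients changes no image
   and makes [p i] homogeneous. *)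
pose p i : {mpoly K[3]} := \sum_(k | down (label k)) D i k *: 'X_[label k].
have ph (i : 'I_r) : p i \is d.-1.-homog.
  apply: rpred_sum => k dk; apply: dhomogZ; rewrite dhomogX /=.
  by move: dk; rewrite downP => /eqP <-.
have pZ i : coef_row (p i) *m Z = row i (row_base Z).
  rewrite DZ row_mul; apply/rowP => j; rewrite !mxE; apply: eq_bigr => k _.
  rewrite !mxE; case: asboolP => [[dk _ _ _]|]; last by rewrite !mulr0.
  congr *%R; rewrite raddf_sum (bigD1 k) //= mcoeffZ mcoeffX eqxx mulr1.
  rewrite big1 ?addr0 // => l /andP[_ /negbTE nel].
  by rewrite mcoeffZ mcoeffX (inj_eq label_inj) nel mulr0.
have coef_lin (c : 'I_r -> K) :
    coef_row (\sum_i c i *: p i) *m Z = (\row_i c i) *m row_base Z.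
  have -> : coef_row (\sum_i c i *: p i) = \sum_i c i *: coef_row (p i).
    apply/rowP => j; rewrite !mxE raddf_sum summxE; apply: eq_bigr => i _.
    by rewrite /= mcoeffZ !mxE.
  rewrite mulmx_suml mulmx_sum_row; apply: eq_bigr => i _.
  by rewrite -scalemxAl pZ mxE.
have sumE (c : 'I_r -> K) : \sum_i c i *: (linear_form a * p i) =
    linear_form a * \sum_i c i *: p i.
  by rewrite mulr_sumr; apply: eq_bigr => i _; rewrite scalerAr.
have sumh (c : 'I_r -> K) : \sum_i c i *: p i \is d.-1.-homog.
  by apply: rpred_sum => i _; apply: dhomogZ.
apply: (dim_modE (s := [tuple linear_form a * p i | i < r])) => //.
split=> [i|c|g [u uh <-]].
- by exists (p i); [exact: ph | rewrite tnth_mktuple].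
- under eq_bigr do rewrite tnth_mktuple.
  rewrite sumE => /(mult_image0 a spI d0 (sumh c)); rewrite coef_lin => c0 i.
  have rf : row_free (row_base Z) := row_base_free _.
  have /rowP/(_ i) : \row_i c i = 0.
    by apply: (row_free_inj rf); rewrite c0 mul0mx.
  by rewrite !mxE.
have /submxP[c Dc] : (coef_row u *m Z <= row_base Z)%MS.
  by rewrite eq_row_base submxMl.
exists (fun i => c 0 i); under eq_bigr do rewrite tnth_mktuple.
rewrite sumE -mulrBr; apply/(mult_image0 a spI d0).
  by apply: rpredB => //; exact: sumh.
have -> : coef_row (u - \sum_i c 0 i *: p i) =
    coef_row u - coef_row (\sum_i c 0 i *: p i).
  by apply/rowP => j; rewrite !mxE mcoeffB.
rewrite mulmxBl coef_lin Dc; apply/eqP; rewrite subr_eq0; apply/eqP.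
by congr mulmx; apply/rowP => i; rewrite mxE.
Qed.

End LefschetzMatrix.

(** * Reduction to unit punctures *)

Lemma mxrank_diag_scale (K : fieldType) m n (A : 'M[K]_(m, n)) (u : 'rV_m) (w : 'rV_n) :
    (forall i, u 0 i != 0) -> (forall j, w 0 j != 0) ->
  \rank (diag_mx u *m A *m diag_mx w) = \rank A.
Proof.
have diag_unit k (x : 'rV[K]_k) : (forall i, x 0 i != 0) -> diag_mx x \in unitmx.
  by move=> x0; rewrite unitmxE det_diag unitfE; apply/prodf_neq0.
move=> /diag_unit u_unit /diag_unit w_unit.
rewrite mxrankMfree ?row_free_unit //.
by rewrite (eqmxMfull A (_ : row_full (diag_mx u))) // row_full_unit.
Qed.

Section PivotExtensions.
Variables (K : fieldType) (d : nat).
Implicit Types (T : set 'X_{1..3}) (a : 'I_3 -> K).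

Local Notation B := 'X_{1..3 < d.+1}.
Local Notation q := #|{: B}|.
Local Notation down := (downward d.+1).
Local Notation up := (upward d.+1).
Local Notation label := (@label d).
Local Notation Z := (@lefschetz_mx K d).

Definition num_down T : nat := #|[pred b : B | down b && `[< T b >]]|.
Definition num_up T : nat := #|[pred b : B | up b && `[< T b >]]|.

(** Writing a^m for [w m], the entry a_v at (n, x_v n) is a^(x_v n) / a^n, so invertible diagonal
    matrices carry the weights 1 to [a]. *)
Lemma lefschetz_rank_scale T a : (forall v, a v != 0) ->
  \rank (Z T a) = \rank (Z T (fun=> 1)).
Proof.
move=> a0; pose w m := \prod_v a v ^+ (m v).
have w0 (m : 'X_{1..3}) : w m != 0.
  by apply/prodf_neq0 => v _; rewrite expf_neq0.
rewrite -[RHS](@mxrank_diag_scale _ _ _ _ (\row_i (w (label i))^-1)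
   (\row_i (w (label i)))) => [|i|i]; rewrite ?mxE ?invr_eq0 //.
congr mxrank; apply/matrixP => i j; rewrite mul_mx_diag mul_diag_mx !mxE.
case: asboolP => _; last by rewrite mulr0 mul0r.
rewrite mulr_sumr mulr_suml; apply: eq_bigr => v _.
case: eqP => [->|_]; last by rewrite !mulr0n mulr0 mul0r.
rewrite !mulr1n /= mulr1; suff -> : w (U_(v) + label i)%MM = a v * w (label i).
  by rewrite mulrCA mulVf ?mulr1.
rewrite /w (bigD1 v) //= [X in _ = _ * X](bigD1 v) //= mulrA; congr *%R.
  by rewrite mnmDE mnm1E eqxx exprS.
by apply: eq_bigr => u /negbTE ne_uv; rewrite mnmDE mnm1E eq_sym ne_uv.
Qed.

(* In the new matrix the row of n has a single nonzero entry, in the new column. *)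
Lemma rank_pivot T n w a : (forall v, a v != 0) -> down n -> ~ T n ->
    (forall v, ~ T (U_(v) + n)%MM) ->
  \rank (Z (T `|` [set n; (U_(w) + n)%MM]) a) = (\rank (Z T a)).+1.
Proof.
move=> a0 dn nT nbrT; set T' := T `|` _.
have [i0 Di0] := down_labelP dn.
have [j0 Dj0] : exists j, label j = (U_(w) + n)%MM.
  by apply: up_labelP; rewrite up_addU.
have up_down m : up m -> m <> n by move=> um eqm; move: um; rewrite eqm down_upF.
have down_up m : down m -> m <> (U_(w) + n)%MM.
  by move=> dm eqm; move: (down_upF dm); rewrite eqm up_addU dn.
(* Only column [j0] changes: the new row of [n] is zero elsewhere, because no other neighbour of [n]
   is present. *)
have eqZ k j : Z T' a k j = Z T a k j + (j == j0)%:R * Z T' a k j0.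
  have [->|nej] := eqVneq j j0.
    rewrite mul1r [X in X + _]mxE; case: asboolP => [[_ _ _]|]; last by rewrite add0r.
    by rewrite Dj0 => /nbrT.
  have nejn : label j <> (U_(w) + n)%MM.
    by rewrite -Dj0 => /(@label_inj d) eqj; rewrite eqj eqxx in nej.
  rewrite mul0r addr0 !mxE; have [eqk|nek] := eqVneq (label k) n.
    rewrite eqk; case: asboolP => [[_ uj _ [Tj|]]|_]; last 1 first.
    - by case: asboolP => // -[].
    - rewrite big1 => [|v _]; first by case: asboolP => // -[].
      by case: eqP => // eqj; case: (nbrT v); rewrite -eqj.
    - by case=> [/(up_down _ uj)|].
  congr (if _ then _ else _).
  apply/asboolP/asboolP => [|[dk uj Tk Tj]]; last by split=> //; left.
  case=> dk uj [Tk|[/eqP|/(down_up _ dk)//]]; last by rewrite (negbTE nek).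
  by case=> [Tj|[/(up_down _ uj)|]].
have Zpivot : Z T' a i0 j0 = a w.
  rewrite mxE Di0 Dj0 up_addU dn; case: asboolP => [_|[]]; last first.
    by split=> //; right; [left|right].
  rewrite (bigD1 w) //= eqxx big1 ?addr0 // => v /negbTE nev.
  by rewrite eqm_add2r eq_mnm1 eq_sym nev.
have ZT_i0 j : Z T a i0 j = 0 by rewrite mxE Di0; case: asboolP => // -[].
have ZT_j0 k : Z T a k j0 = 0.
  by rewrite mxE Dj0; case: asboolP => // -[_ _ _ /nbrT].
pose D : 'rV[K]_q := delta_mx 0 j0.
have row_eq k : row k (Z T' a) = row k (Z T a) + Z T' a k j0 *: D.
  apply/rowP => j; rewrite [LHS]mxE eqZ [RHS]mxE [row k _ 0 j]mxE.
  by rewrite [(_ *: D) 0 j]mxE [D 0 j]mxE eqxx /= mulrC.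
have subD : (D <= Z T' a)%MS.
  have := row_sub i0 (Z T' a); rewrite row_eq.
  have -> : row i0 (Z T a) = 0 by apply/rowP => j; rewrite [LHS]mxE ZT_i0 [RHS]mxE.
  by rewrite add0r Zpivot eqmx_scale.
(* The rows agree modulo [D], and the new row [i0] is a nonzero multiple of [D]. *)
have eqmxZ : (Z T' a :=: Z T a + D)%MS.
  apply/eqmxP/andP; split.
    apply/row_subP => k; rewrite row_eq addmx_sub_adds ?row_sub //.
    exact: scalemx_sub.
  rewrite addsmx_sub subD andbT; apply/row_subP => k.
  have -> : row k (Z T a) = row k (Z T' a) - Z T' a k j0 *: D.
    by rewrite row_eq addrK.
  by rewrite addmx_sub ?row_sub // eqmx_opp scalemx_sub.
rewrite eqmxZ mxrank_disjoint_sum.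
  by rewrite mxrank_delta addn1.
(* Column [j0] of the old matrix is zero, so the line of [D] meets its row space trivially. *)
apply/eqP/rowV0P => u; rewrite sub_capmx => /andP[/submxP[y Dy] /sub_rVP[c Dc]].
have : u 0 j0 = 0 by rewrite Dy mxE big1 // => k _; rewrite ZT_j0 mulr0.
by rewrite Dc [LHS]mxE [D 0 j0]mxE !eqxx mulr1 => ->; rewrite scale0r.
Qed.

(** Chains of the enlargements to which [rank_pivot] applies. *)
Inductive pivot_ext T : set 'X_{1..3} -> Prop :=
| pivot_refl : pivot_ext T T
| pivot_step T1 n w of pivot_ext T T1 & down n & ~ T1 n
    & (forall v, ~ T1 (U_(v) + n)%MM) :
    pivot_ext T (T1 `|` [set n; (U_(w) + n)%MM]).

Lemma pivot_trans T1 T2 T3 : pivot_ext T1 T2 -> pivot_ext T2 T3 -> pivot_ext T1 T3.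
Proof. by move=> T12; elim=> // T n w _ IH dn nT nbrT; apply: pivot_step. Qed.

Lemma num_down_pivot T n w : down n -> ~ T n ->
  num_down (T `|` [set n; (U_(w) + n)%MM]) = (num_down T).+1.
Proof.
move=> dn nT; have ltn_d : (mdeg n < d.+1)%N.
  by move: dn; rewrite downP => /eqP; lia.
rewrite /num_down [RHS](_ : _ = #|[predU1 (BMultinom ltn_d) &
    [pred b : B | down b && `[< T b >]]]|).
  apply: eq_card => b; rewrite !inE /= bmeqP /=.
  apply/andP/orP => [[db /asboolP[Tb|[->|eqb]]]|[/eqP->|/andP[db /asboolP Tb]]].
  - by right; rewrite db; apply/asboolP.
  - by left.
  - by move: (down_upF db); rewrite eqb up_addU dn.
  - by split=> //; apply/asboolP; right; left.
  - by split=> //; apply/asboolP; left.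
rewrite cardU1 inE /= dn; case: asboolP => // _.
Qed.

Lemma num_up_pivot T n w : down n -> ~ T (U_(w) + n)%MM ->
  num_up (T `|` [set n; (U_(w) + n)%MM]) = (num_up T).+1.
Proof.
move=> dn nT; have ltn_d : (mdeg (U_(w) + n)%MM < d.+1)%N.
  by move: dn; rewrite mdegD mdeg1 downP => /eqP; lia.
rewrite /num_up [RHS](_ : _ = #|[predU1 (BMultinom ltn_d) &
    [pred b : B | up b && `[< T b >]]]|).
  apply: eq_card => b; rewrite !inE /= bmeqP /=.
  apply/andP/orP => [[db /asboolP[Tb|[eqb|->]]]|[/eqP->|/andP[db /asboolP Tb]]].
  - by right; rewrite db; apply/asboolP.
  - by move: db; rewrite eqb down_upF.
  - by left.
  - by rewrite up_addU; split=> //; apply/asboolP; right; right.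
  - by split=> //; apply/asboolP; left.
by rewrite cardU1 inE /= up_addU dn; case: asboolP.
Qed.

Lemma pivot_ext_invariants T T' a : (forall v, a v != 0) -> pivot_ext T T' ->
  exists k, [/\ num_down T' = (num_down T + k)%N, num_up T' = (num_up T + k)%N
              & \rank (Z T' a) = (\rank (Z T a) + k)%N].
Proof.
move=> a0; elim=> [|T1 n w _ [k [eq_d eq_u eq_r]] dn nT nbrT].
  by exists 0%N; rewrite !addn0.
exists k.+1; rewrite num_down_pivot // num_up_pivot // rank_pivot //.
by rewrite eq_d eq_u eq_r !addnS.
Qed.

End PivotExtensions.

(** A discrete intermediate value theorem; it will show that the positions occupied by a gap form an
    interval. *)
Lemma sorted_ivt (T : eqType) (e : rel T) (f : T -> nat) (s : seq T) :
    {in s &, forall x y, e x y -> (f x <= (f y).+1)%N && (f y <= (f x).+1)%N} ->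
    sorted e s ->
  {in s &, forall x y k, (f x <= k <= f y)%N -> exists2 z, z \in s & f z = k}.
Proof.
move=> fe.
suff from_head x p : {subset x :: p <= s} -> path e x p ->
    forall y k, y \in x :: p ->
      (f x <= k <= f y)%N || (f y <= k <= f x)%N -> exists2 z, z \in s & f z = k.
  case: s fe from_head => [|x p] fe // from_head e_xp y z ys zs k k_yz.
  (* Whichever side of [k] the head lies on, one of [y] and [z] lies on the other. *)
  case: (leqP k (f x)) => [le_k|lt_k].
    by apply: (from_head x p) (ys) _ => //; lia.
  by apply: (from_head x p) (zs) _ => //; lia.
elim: p x => [|x' p IHp] x sub_s /=.
  move=> _ y k; rewrite inE => /eqP-> fk; exists x; last by lia.
  by apply: sub_s; rewrite inE.
case/andP=> e_xx' e_p y k; rewrite inE => y_xp fk.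
have sub_p : {subset x' :: p <= s} by move=> z zp; apply: sub_s; rewrite inE zp orbT.
have xs : x \in s by apply: sub_s; rewrite inE eqxx.
have x's : x' \in s by apply: sub_p; rewrite inE eqxx.
have [->|nek] := eqVneq k (f x); first by exists x.
case/orP: y_xp => [/eqP eqy|yp]; first by subst y; lia.
have := fe _ _ xs x's e_xx'.
by move=> /andP[? ?]; apply: (IHp x' sub_p e_p y) => //; lia.
Qed.

Lemma ord3_third (v w : 'I_3) : v != w ->
  exists u, [/\ u != v, u != w & forall x, [|| x == v, x == w | x == u]].
Proof.
case: v w => [[|[|[|//]]] ?] [[|[|[|//]]] ?] // _;
by [exists (@Ordinal 3 0 isT); split=> //; case=> [[|[|[|//]]] ?]
   |exists (@Ordinal 3 1 isT); split=> //; case=> [[|[|[|//]]] ?]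
   |exists (@Ordinal 3 2 isT); split=> //; case=> [[|[|[|//]]] ?]].
Qed.

Lemma mdeg3 (v w u : 'I_3) (m : 'X_{1..3}) : v != w -> u != v -> u != w ->
  mdeg m = (m v + m w + m u)%N.
Proof.
move=> ne_vw ne_uv ne_uw.
rewrite mdegE (bigD1 v) //= (bigD1 w) 1?eq_sym //= (bigD1 u) ?ne_uv ?ne_uw //=.
rewrite big1 ?addn0 ?addnA // => x; move: ne_vw ne_uv ne_uw.
by case: v w u x => [[|[|[|//]]] ?] [[|[|[|//]]] ?] [[|[|[|//]]] ?] [[|[|[|//]]] ?].
Qed.

(** * Filling a gap in a row by pivot extensions *)

Section Reduction.
Variables (K : fieldType) (d : nat).
Implicit Types (T : set 'X_{1..3}) (s : seq 'X_{1..3}).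

Local Notation down := (downward d.+1).
Local Notation up := (upward d.+1).
Local Notation pivot_ext := (@pivot_ext d).

(* Along a row where v is constant, row_pos w runs through consecutive integers, for
   each w <> v; the two choices of w give the two orientations. *)
Definition row_pos (w : 'I_3) (m : 'X_{1..3}) : nat := ((m w).*2 + down m)%N.

Lemma label_addU_down j m :
  up (U_(j) + m)%MM || down (U_(j) + m)%MM -> up m || down m -> down m.
Proof. by rewrite !upP !downP mdegD mdeg1 => ? ?; lia. Qed.

Lemma pos_addU w j m : down m ->
  row_pos w (U_(j) + m)%MM = ((j == w) + m w).*2 /\ row_pos w m = (m w).*2.+1.
Proof.
move=> dm; rewrite /row_pos dm addn1 mnmDE mnm1E; split=> //.
case: (boolP (down _)) => [/down_upF|_]; last by rewrite addn0.
by rewrite up_addU dm.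
Qed.

Section Gap.
Variables (T : set 'X_{1..3}) (v : 'I_3) (i : nat) (s : seq 'X_{1..3}).
Hypotheses (T_closed : up_closed d T) (s_max : is_max_gap d.+1 T v i s).

Let s_gap : is_gap d.+1 T v i s := proj1 s_max.

Lemma gap_mem m : m \in s -> [/\ up m || down m, m v = i & ~ T m].
Proof. by case: s_gap => h _ _; exact: h. Qed.

Lemma gap_adjacent_pos w : w != v ->
  {in s &, forall m1 m2, adjacent m1 m2 ->
     (row_pos w m1 <= (row_pos w m2).+1)%N && (row_pos w m2 <= (row_pos w m1).+1)%N}.
Proof.
move=> ne_wv m1 m2 s1 s2 /existsP[j].
have adj x y : x \in s -> y \in s -> x = (U_(j) + y)%MM ->
    (row_pos w x <= (row_pos w y).+1)%N && (row_pos w y <= (row_pos w x).+1)%N.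
  move=> sx sy eqx; have [udx _ _] := gap_mem sx; have [udy _ _] := gap_mem sy.
  rewrite eqx in udx *; have [-> ->] := pos_addU w j (label_addU_down udx udy).
  by case: (j == w); lia.
by case/orP=> /eqP eqm; [|rewrite andbC]; apply: adj.
Qed.

Lemma gap_between w m1 m2 k : w != v -> m1 \in s -> m2 \in s ->
  (row_pos w m1 <= k <= row_pos w m2)%N -> exists2 m, m \in s & row_pos w m = k.
Proof.
move=> ne_wv s1 s2; case: s_gap => _ _ sort_s.
exact: (sorted_ivt (gap_adjacent_pos ne_wv) sort_s s1 s2).
Qed.

Lemma gap_pos_inj w m1 m2 : w != v -> m1 \in s -> m2 \in s ->
  row_pos w m1 = row_pos w m2 -> m1 = m2.
Proof.
move=> ne_wv s1 s2; have [ud1 v1 _] := gap_mem s1; have [ud2 v2 _] := gap_mem s2.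
rewrite /row_pos => eq_pos.
have eq_w : m1 w = m2 w by case: (down m1) (down m2) eq_pos => [] []; lia.
have eq_d : down m1 = down m2 by case: (down m1) (down m2) eq_pos => [] []; lia.
have eq_deg : mdeg m1 = mdeg m2 by move: ud1 ud2 eq_d; rewrite !upP !downP; lia.
have [u [ne_uw ne_uv all_u]] := ord3_third ne_wv.
move: eq_deg; rewrite !(mdeg3 _ ne_wv ne_uw ne_uv) eq_w v1 v2 => /addnI eq_u.
by apply/mnmP => x; case/or3P: (all_u x) => /eqP-> //; rewrite v1 v2.
Qed.

(** By maximality of the gap. A downward triangle has just two neighbours in its row: if [n] ends
    the sequence, a missing neighbour could be attached there; otherwise the two members next to [n]
    are these neighbours. *)
Lemma gap_addU w n : w != v -> n \in s -> down n -> (U_(w) + n)%MM \in s.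
Proof.
move=> ne_wv sn dn; have [udn vn nTn] := gap_mem sn.
set m := (U_(w) + n)%MM; apply: contrapT => /negP sm.
have um : up m by rewrite up_addU.
have m_ok : [/\ up m || down m, m v = i & ~ T m].
  split; first by rewrite um.
    by rewrite mnmDE mnm1E (negbTE ne_wv).
  by apply: contra_not nTn; exact: T_closed.
have nb x : x \in s -> adjacent x n || adjacent n x ->
    exists2 j, j != v & x = (U_(j) + n)%MM.
  move=> sx adj; have [udx vx _] := gap_mem sx.
  have [j /orP[/eqP eqx|/eqP eqn]] : exists j : 'I_3,
      (x == U_(j) + n)%MM || (n == U_(j) + x)%MM.
    by case/orP: adj => /existsP[j]; [|rewrite orbC]; exists j.
    exists j => //; apply/eqP => eqj.
    by move: vx; rewrite eqx mnmDE mnm1E eqj eqxx vn; lia.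
  by move: dn udx; rewrite eqn !upP !downP mdegD mdeg1; lia.
have adj_mn : adjacent m n by apply/existsP; exists w; rewrite eqxx.
have adj_nm : adjacent n m by apply/existsP; exists w; rewrite eqxx orbT.
case: s_max => -[mem_s uniq_s sort_s] max_s.
have absurd s' : perm_eq s' (m :: s) -> sorted adjacent s' -> False.
  move=> perm_s' sort_s'; case/negP: (sm).
  apply: (max_s s'); last by rewrite (perm_mem perm_s') inE eqxx.
    split=> //; last by rewrite (perm_uniq perm_s') /= sm.
    by move=> x; rewrite (perm_mem perm_s') inE => /predU1P[->|/mem_s].
  by move=> x sx; rewrite (perm_mem perm_s') inE sx orbT.
case/splitPr: sn uniq_s sort_s sm absurd nb => s1 s2 uniq_s sort_s sm absurd nb.
(* [n] comes first: prepend [m]. *)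
case: (lastP s1) uniq_s sort_s sm absurd nb => [|s1' l] uniq_s sort_s sm absurd nb.
  by apply: (absurd (m :: n :: s2)) => //=; rewrite adj_mn.
(* [n] comes last: append [m]. *)
case: s2 => [|r s2] in uniq_s sort_s sm absurd nb *.
  apply: (absurd (rcons (rcons s1' l ++ [:: n]) m)).
    by rewrite perm_rcons.
  move: sort_s; rewrite cats1; case: (rcons s1' l) => [|x p] /= sort_s.
    by rewrite adj_nm.
  by rewrite rcons_path sort_s last_rcons adj_nm.
(* [n] is inside: the members [l] and [r] next to it use up both directions other than [v]. *)
have [j ne_jv Dl] : exists2 j, j != v & l = (U_(j) + n)%MM.
  apply: nb; first by rewrite mem_cat mem_rcons inE eqxx.
  by move: sort_s; rewrite cat_rcons => /cat_sorted2[_ /andP[->]].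
have [k ne_kv Dr] : exists2 k, k != v & r = (U_(k) + n)%MM.
  apply: nb; first by rewrite mem_cat !inE eqxx !orbT.
  by move: sort_s => /cat_sorted2[_ /andP[->]]; rewrite orbT.
have ne_jk : j != k.
  apply: contraTN uniq_s => /eqP eq_jk; rewrite cat_uniq; apply/nandP; right.
  apply/nandP; left; rewrite negbK; apply/hasP; exists r.
    by rewrite !inE eqxx orbT.
  by rewrite Dr -eq_jk -Dl mem_rcons inE eqxx.
have ne_jw : j != w.
  by apply: contraNneq sm => eqj; rewrite /m -eqj -Dl mem_cat mem_rcons inE eqxx.
have ne_kw : k != w.
  by apply: contraNneq sm => eqk; rewrite /m -eqk -Dr mem_cat !inE eqxx !orbT.
have [u [_ _ all_u]] := ord3_third ne_wv.
case/or3P: (all_u j) ne_jv ne_jw => /eqP Dj; rewrite ?Dj ?eqxx // => _ _.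
case/or3P: (all_u k) ne_kv ne_kw => /eqP Dk; rewrite ?Dk ?eqxx // => _ _.
by move: ne_jk; rewrite Dj Dk eqxx.
Qed.

Variable P : 'X_{1..3}.
Hypotheses (sP : P \in s) (uP : up P).

Definition gap_before w := [set m | m \in s /\ (row_pos w m < row_pos w P)%N].

(** Filling goes from the end of the gap towards [P]. A downward triangle at position 2k + 1 is
    added with the upward one behind it, at 2k; the one ahead, at 2k + 2, is still missing, and the
    third neighbour lies in another row. [T0] may differ from [T] because the second side is filled
    after the first. *)
Lemma pivot_before w T0 : w != v ->
    (forall m, m \in s -> (row_pos w m <= row_pos w P)%N -> ~ T0 m) ->
    (forall n, n \in s -> down n -> ~ T0 (U_(v) + n)%MM) ->
  pivot_ext T0 (T0 `|` gap_before w).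
Proof.
move=> ne_wv sT0 vT0; have [u [ne_uw ne_uv all_u]] := ord3_third ne_wv.
have posP : row_pos w P = (P w).*2.
  by rewrite /row_pos; case: (boolP (down P)) => [/down_upF|_]; [rewrite uP|lia].
pose L k := [set m | m \in s /\ (row_pos w m < k.*2)%N].
suff ext k : (k <= P w)%N -> pivot_ext T0 (T0 `|` L k).
  by have := ext _ (leqnn _); rewrite /gap_before posP.
elim: k => [_|k IHk lt_k].
  rewrite (_ : L 0 = set0) ?setU0; first exact: pivot_refl.
  by apply/seteqP; split=> // m [].
have {}IHk := IHk (ltnW lt_k).
case: (pselect (exists2 n, n \in s & row_pos w n = k.*2.+1)) => [[n sn posn]|non].
  have dn : down n by move: posn; rewrite /row_pos; case: (down n) => //; lia.
  have [posn' nw] := pos_addU w w dn; rewrite eqxx in posn'.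
  have [posm _] := pos_addU w u dn; rewrite (negbTE ne_uw) in posm.
  have sm := gap_addU ne_uv sn dn; have swn := gap_addU ne_wv sn dn.
  have -> : T0 `|` L k.+1 = (T0 `|` L k) `|` [set n; (U_(u) + n)%MM].
    rewrite -setUA; congr (_ `|` _); apply/seteqP; split=> [m [s_m lt_m]|m].
      have [lt_mk|ge_mk] := ltnP (row_pos w m) k.*2; first by left.
      right; have [eqm|nem] := eqVneq (row_pos w m) k.*2.
        by right; apply: (gap_pos_inj ne_wv) => //; rewrite eqm posm; lia.
      by left; apply: (gap_pos_inj ne_wv) => //; rewrite posn; lia.
    case=> [[s_m lt_m]|[->|->]]; first by split=> //; lia.
      by split=> //; rewrite posn; lia.
    by split=> //; rewrite posm; lia.
  apply: pivot_step => // [[|[_]]|x [|[s_x]]].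
  - by apply: sT0 => //; rewrite posn posP; lia.
  - by rewrite posn; lia.
  - case/or3P: (all_u x) => /eqP->.
    + by apply: sT0 => //; rewrite posn' posP; lia.
    + exact: vT0.
    + by apply: sT0 => //; rewrite posm posP; lia.
  - case/or3P: (all_u x) => /eqP Dx; rewrite Dx in s_x *.
    + by rewrite posn'; lia.
    + have [_ + _] := gap_mem s_x; have [_ + _] := gap_mem sn.
      by rewrite mnmDE mnm1E eqxx => -> ; lia.
    + by rewrite posm; lia.
(* The positions of the gap form an interval containing that of [P]; as 2k + 1 is missing, it starts
   beyond. *)
suff -> : L k.+1 = L k by [].
apply/seteqP; split=> m [s_m lt_m]; split=> //; last by lia.
rewrite ltnNge; apply/negP => le_m; apply: non.
by apply: (@gap_between w m P) => //; rewrite posP; lia.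
Qed.

End Gap.

Lemma reduction_step_pivot T T' : reduction_step K d.+1 T T' -> pivot_ext T T'.
Proof.
case=> v [i [s [P [[g [[J [[J_mon DT] _] _] _ _]] _ [s_max _] [sP uP] ->]]]].
have T_closed : up_closed d T.
  by rewrite DT; apply: region_up_closed; have [] := monomial_ideal_spanned J_mon.
have [w ne_wv] : exists w, w != v.
  by case: v {s_max} => [[|[|[|//]]] ?]; [exists ord_max|exists ord0|exists ord0].
have [u [ne_uw ne_uv all_u]] := ord3_third ne_wv.
have nT := gap_mem s_max.
(* The two orientations have constant sum, so what lies beyond [P] for one lies before [P] for the
   other. *)
have pos_sum m : m \in s -> (row_pos w m + row_pos u m = (d - i).*2)%N.
  move=> /nT[udm vm _]; have := mdeg3 m ne_wv ne_uw ne_uv.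
  by move: udm; rewrite /row_pos !upP !downP vm; case: eqP; lia.
have -> : T `|` ([set` s] `\ P) =
    (T `|` gap_before s P w) `|` gap_before s P u.
  rewrite -setUA; congr (_ `|` _); apply/seteqP; split=> [m [/= s_m neP]|m].
    have := pos_sum _ s_m; have := pos_sum _ sP => sumP sumM.
    have neq : row_pos w m <> row_pos w P.
      by move=> eqm; apply: neP; apply: (gap_pos_inj s_max ne_wv).
    have [lt_m|ge_m] := ltnP (row_pos w m) (row_pos w P); first by left.
    by right; split=> //; lia.
  by case=> -[s_m lt_m]; split=> // eqP; move: lt_m; rewrite eqP ltnn.
have vnT n : n \in s -> down n -> forall x, ~ T (U_(x) + n)%MM.
  by move=> /nT[_ _ nTn] dn x; apply: contra_not nTn; exact: T_closed.
apply: (@pivot_trans _ _ (T `|` gap_before s P w)).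
  apply: (pivot_before T_closed s_max sP uP ne_wv) => [m /nT[]//|n sn dn].
  exact: vnT.
apply: (pivot_before T_closed s_max sP uP ne_uv) => [m sm le_m [|[_ lt_m]]|].
- by have [] := nT _ sm.
- by have := pos_sum _ sm; have := pos_sum _ sP; lia.
move=> n sn dn [|[s_vn _]]; first exact: vnT.
have [_ + _] := nT _ s_vn; have [_ + _] := nT _ sn.
by rewrite mnmDE mnm1E eqxx => ->; lia.
Qed.

Lemma reduction_pivot T T' :
  reduction_to_unit_punctures K d.+1 T T' -> pivot_ext T T'.
Proof.
case=> + _; elim=> [T1 T2 /reduction_step_pivot//|T1|T1 T2 T3 _ IH1 _ IH2].
  exact: pivot_refl.
exact: pivot_trans IH1 IH2.
Qed.

End Reduction.

(** * Toric varieties of monomials *)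

Section Toric.
Variables (K : fieldType) (charK : [pchar K] =i pred0).
Variables (N d : nat) (mm : 'I_N -> 'X_{1..3}) (f : N.-tuple {mpoly K[3]}).
Hypotheses (d_gt0 : (0 < d)%N) (mm_deg : forall j, mdeg (mm j) = d).
Hypothesis fE : forall j, tnth f j = 'X_[mm j].
Variable base : 'I_3 -> 'I_N.
Hypothesis base_det :
  \det (\matrix_(i < 3, v < 3) (mm (base i) v)%:Z : 'M[int]_3) != 0.

Implicit Types (P : 'I_N -> K) (F : {mpoly K[N]}) (b : 'X_{1..N}).

Local Notation X := (image_closure f).

(** The exponent of the monomial into which w^b turns under w_j = x^(mm j). *)
Definition weight b : 'X_{1..3} := (\big[+%MM/0%MM]_j (mm j *+ b j))%MM.

Lemma weightE b v : weight b v = (\sum_j mm j v * b j)%N.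
Proof. by rewrite /weight mnm_sumE; apply: eq_bigr => j _; rewrite mulmnE. Qed.

Lemma mdeg_weight b : mdeg (weight b) = (d * mdeg b)%N.
Proof.
rewrite mdeg_sum mdegE big_distrr; apply: eq_bigr => j _ /=.
by rewrite mdegMn mm_deg.
Qed.

Lemma prod_scaleX (A : comNzRingType) (x : 'I_N -> A) (t : 'I_3 -> A) b :
  \prod_j (x j * \prod_v t v ^+ (mm j v)) ^+ b j =
  (\prod_j x j ^+ b j) * \prod_v t v ^+ weight b v.
Proof.
under eq_bigr do rewrite exprMn.
rewrite big_split; congr *%R.
under [RHS]eq_bigr do rewrite weightE expr_sum.
rewrite exchange_big; apply: eq_bigr => j _ /=.
by rewrite -prodrXl; apply: eq_bigr => v _; rewrite exprM.
Qed.

Lemma image_point p (j : 'I_N) : (forall v, p v != 0) ->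
  X (fun j => (tnth f j).@[p]).
Proof.
move=> p0; have nz k : (tnth f k).@[p] != 0.
  by rewrite fE mevalX; apply/prodf_neq0 => v _; rewrite expf_neq0.
split; first by exists j.
by move=> F [_]; apply; split; [exists j | exists p].
Qed.

Lemma vanishing_formsP F : vanishing_forms X F <->
  (exists k, F \is k.-homog) /\
  forall p, (exists j, (tnth f j).@[p] != 0) -> F.@[fun j => (tnth f j).@[p]] = 0.
Proof.
split=> [[Fh FX]|[Fh Fp]]; split=> //.
  move=> p nzp; apply: FX; split=> // G [_]; apply.
  by split=> //; exists p.
move=> P [_]; apply; split=> // Q [nzQ [p DQ]].
by rewrite DQ; apply: Fp; rewrite DQ in nzQ.
Qed.

Definition orbit_poly P F : {mpoly K[3]} :=
  \sum_(b <- msupp F) (F@_b * \prod_j P j ^+ b j) *: 'X_[weight b].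

(* X is stable under the torus action t.P = (t^(mm j) P_j)_j, so F vanishes
   identically on the orbit of P. *)
Lemma orbit_poly0 P F : X P -> vanishing_forms X F -> orbit_poly P F = 0.
Proof.
move=> XP vF; apply: contrapT => /eqP nz.
(* The factor xyz forces a point where [G] is nonzero into the torus. *)
pose G : {mpoly K[3]} := orbit_poly P F * 'X_[[multinom 1%N | i < 3]].
have [t] : exists t, G.@[t] != 0.
  apply: mpoly_nonvanishing => //; rewrite mulf_neq0 //.
  by rewrite -msupp_eq0 msuppX.
rewrite mevalM mulf_eq0 negb_or => /andP[Gt]; rewrite mevalX => /prodf_neq0 t0.
have {}t0 v : t v != 0 by have := t0 v isT; rewrite mnmE.
case/negP: Gt; have [[k Fk] Fp] := (vanishing_formsP F).1 vF.
(* [Ft] is [F] composed with the action of [t]; it vanishes on the image, hence on its closure, in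
   particular at [P]. *)
pose Ft := \sum_(b <- msupp F) (F@_b * \prod_v t v ^+ weight b v) *: 'X_[K, b].
have FtE Q : Ft.@[Q] = F.@[fun j => Q j * \prod_v t v ^+ (mm j v)].
  rewrite raddf_sum mevalE; apply: eq_bigr => b _ /=.
  by rewrite mevalZ mevalX prod_scaleX -mulrA; congr *%R; rewrite mulrC.
have vFt : vanishing_forms X Ft.
  apply/vanishing_formsP; split.
    exists k; rewrite /Ft big_seq; apply: rpred_sum => b Fb; apply: dhomogZ.
    by rewrite dhomogX; apply/eqP; move/dhomogP: Fk; apply.
  move=> p [j nzj]; rewrite FtE -[RHS](Fp (fun v => t v * p v)); last first.
    exists j; move: nzj; rewrite fE !mevalX.
    under [X in _ -> X != 0]eq_bigr do rewrite exprMn.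
    rewrite big_split => nzj; rewrite mulf_neq0 //.
    by apply/prodf_neq0 => v _; rewrite expf_neq0.
  apply: meval_eq => i; rewrite !fE !mevalX -big_split.
  by apply: eq_bigr => v _; rewrite exprMn mulrC.
have : Ft.@[P] = 0 by case: vFt => _; apply.
rewrite raddf_sum => FtP; apply/eqP; rewrite -[RHS]FtP raddf_sum.
apply: eq_bigr => b _ /=; rewrite !mevalZ !mevalX -!mulrA; congr *%R.
exact: mulrC.
Qed.

(** Both terms pull back to the same monomial. Equal weights give equal degrees because [d] is
    positive, so the difference is homogeneous. *)
Lemma binomial_vanishing b1 b2 : weight b1 = weight b2 ->
  vanishing_forms X ('X_[b1] - 'X_[b2]).
Proof.
move=> eq_w; apply/vanishing_formsP; split.
  exists (mdeg b1); apply: rpredB; rewrite dhomogX //.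
  have : (d * mdeg b2 = d * mdeg b1)%N by rewrite -!mdeg_weight eq_w.
  by move/eqP; rewrite eqn_pmul2l.
move=> p _.
have evX b : ('X_[b] : {mpoly K[N]}).@[fun j => (tnth f j).@[p]] =
    \prod_v p v ^+ weight b v.
  have /esym := prod_scaleX (fun=> 1) p b.
  rewrite [\prod_j _ ^+ _]big1 => [|j _]; last exact: expr1n.
  rewrite mul1r => ->; rewrite mevalX; apply: eq_bigr => j _.
  by rewrite fE mevalX mul1r.
by rewrite mevalB !evX eq_w subrr.
Qed.

Definition pos_part (c : 'I_N -> int) : 'X_{1..N} :=
  [multinom (if (0 <= c j)%R then `|c j|%N else 0%N) | j < N].

Lemma pos_partB c j :
  (pos_part c j)%:Z - (pos_part (fun k => - c k) j)%:Z = c j.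
Proof. by rewrite !mnmE; case: ifP; case: ifP; lia. Qed.

(** With [binomial_vanishing], an integral relation [c] among the exponents yields the binomial
    w^(c+) - w^(c-) vanishing on the variety. *)
Lemma weight_pos_part c : (forall v, \sum_j c j * (mm j v)%:Z = 0) ->
  weight (pos_part c) = weight (pos_part (fun k => - c k)).
Proof.
move=> c0; apply/mnmP => v; rewrite !weightE; apply/eqP.
rewrite -eqz_nat -subr_eq0 !(big_morph Posz PoszD (erefl 0%:Z)) -sumrB.
apply/eqP; rewrite -[RHS](c0 v); apply: eq_bigr => j _.
by rewrite !PoszM -mulrBr pos_partB mulrC.
Qed.


Lemma base_inj : injective base.
Proof.
move=> i k eq_ik; apply/eqP; apply: contraT => ne_ik; case/negP: base_det.
by apply/eqP; apply: (determinant_alternate ne_ik) => v; rewrite !mxE eq_ik.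
Qed.

Definition base_mx : 'M[K]_3 := \matrix_(i, v) (mm (base i) v)%:R.

Lemma base_mx_unit : base_mx \in unitmx.
Proof.
rewrite unitmxE unitfE.
have -> : base_mx = map_mx intr (\matrix_(i < 3, v < 3) (mm (base i) v)%:Z).
  by apply/matrixP => i v; rewrite !mxE -pmulrn.
by rewrite det_map_mx pchar0_intr_neq0.
Qed.

(** Cramer's rule, kept over the integers because relations are turned into binomials. *)
Lemma base_relation j : exists (D : int) (C : 'I_3 -> int), D != 0 /\
  forall v, D * (mm j v)%:Z = \sum_i C i * (mm (base i) v)%:Z.
Proof.
pose E : 'M[int]_3 := \matrix_(i, v) (mm (base i) v)%:Z.
pose x : 'rV[int]_3 := \row_v (mm j v)%:Z.
exists (\det E), (fun i => (x *m \adj E) 0 i); split=> // v.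
have /rowP/(_ v) : x *m \adj E *m E = \det E *: x.
  by rewrite -mulmxA mul_adj_mx mul_mx_scalar.
rewrite [RHS]mxE [x 0 v]mxE => <-; rewrite [LHS]mxE.
by apply: eq_bigr => i _; rewrite [E i v]mxE.
Qed.

Lemma image_closure_ones : X (fun=> 1).
Proof.
have -> : (fun=> 1) = (fun j => (tnth f j).@[fun=> 1]) :> ('I_N -> K).
  apply/funext => j; rewrite fE mevalX big1 // => v _; exact: expr1n.
by apply: (image_point (base ord0)) => v; exact: oner_neq0.
Qed.

(** Monomials in the base coordinates have distinct weights, as the base matrix is invertible; so
    nothing cancels in the orbit polynomial at (1, ..., 1). *)
Lemma base_alg_independent : alg_independent X [set base i | i : 'I_3].
Proof.
set A := [set _ | _ : _]; move=> F FA vF; apply: contrapT => /eqP nzF.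
have orb0 := orbit_poly0 image_closure_ones vF.
have wt_inj : {in msupp F &, injective weight}.
  move=> b1 b2 Fb1 Fb2 eq_w; apply/mnmP => j.
  have [/imsetP[i _ ->]|jA] := boolP (j \in A); last by rewrite !FA.
  pose r (b : 'X_{1..N}) : 'rV[K]_3 := \row_i (b (base i))%:R.
  have rE b : b \in msupp F -> r b *m base_mx = \row_v (weight b v)%:R.
    move=> Fb; apply/rowP => v; rewrite !mxE weightE natr_sum.
    rewrite [RHS](bigID (mem A)) /= [X in _ = _ + X]big1 ?addr0; last first.
      by move=> k kA; rewrite (FA _ Fb) // muln0.
    rewrite big_imset /=; last by move=> ? ? _ _; exact: base_inj.
    by apply: eq_bigr => k _; rewrite !mxE natrM mulrC.
  have : r b1 = r b2.
    by apply: (can_inj (mulmxK base_mx_unit)); rewrite !rE // eq_w.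
  by move/rowP/(_ i); rewrite !mxE; exact: pchar0_natr_inj.
have m0s := mlead_supp nzF; set b0 := mlead F in m0s.
move/mpolyP/(_ (weight b0)): orb0; rewrite mcoeff0 raddf_sum /=.
rewrite (bigD1_seq b0) ?msupp_uniq //= [X in _ + X]big1_seq ?addr0 => [|b /andP[ne_b Fb]].
  rewrite mcoeffZ mcoeffX eqxx mulr1 [X in _ * X]big1 => [|j _]; last exact: expr1n.
  by rewrite mulr1 => /eqP; rewrite mcoeff_eq0 m0s.
rewrite mcoeffZ mcoeffX; case: eqP => [/wt_inj eqb|]; last by rewrite mulr0.
by rewrite eqb ?eqxx in ne_b.
Qed.

(** More than three vectors of Q^3 are dependent; the factor [D] clears the denominators. *)
Lemma int_relation (A : {set 'I_N}) : (3 < #|A|)%N ->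
  exists c : 'I_N -> int, [/\ forall j, j \notin A -> c j = 0, exists j, c j != 0
    & forall v, \sum_j c j * (mm j v)%:Z = 0].
Proof.
move=> A3; pose M : 'M[rat]_(#|A|, 3) := \matrix_(i, v) (mm (enum_val i) v)%:R.
have /rowV0Pn[u /sub_kermxP uM nzu] : kermx M != 0.
  rewrite kermx_eq0; apply: contraL A3 => /eqP <-.
  by rewrite -leqNgt rank_leq_col.
pose D : int := \prod_i denq (u 0 i).
pose z i : int := numq (u 0 i) * \prod_(k | k != i) denq (u 0 k).
have zE i : (z i)%:Q = D%:Q * u 0 i.
  rewrite /D (bigD1 i) //= /z !rmorphM /= -[X in _ = _ * _ * X]divq_num_den.
  by rewrite [RHS]mulrC mulrA divfK ?intr_eq0 ?denq_neq0.
have D0 : D%:Q != 0.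
  by rewrite intr_eq0; apply/prodf_neq0 => i _; exact: denq_neq0.
pose c j := \sum_(i < #|A|) (if enum_val i == j then z i else 0).
have cE i : c (enum_val i) = z i.
  rewrite /c (bigD1 i) //= eqxx big1 ?addr0 // => k /negbTE nek.
  by rewrite (inj_eq enum_val_inj) nek.
exists c; split=> [j jA||v].
- rewrite /c big1 // => i _; case: eqP => // eqj.
  by rewrite -eqj enum_valP in jA.
- have /rV0Pn[i ui] := nzu; exists (enum_val i).
  by rewrite cE -(intr_eq0 rat) zE mulf_neq0.
apply/eqP; rewrite -(intr_eq0 rat) rmorph_sum /=.
rewrite (bigID (mem A)) /= [X in _ + X]big1 ?addr0; last first.
  move=> j jA; rewrite [c j]big1 ?mul0r // => i _; case: eqP => // eqj.
  by rewrite -eqj enum_valP in jA.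
rewrite big_enum_val /=; apply/eqP.
transitivity (D%:Q * (u *m M) 0 v); last by rewrite uM mxE mulr0.
rewrite mxE mulr_sumr; apply: eq_bigr => i _.
by rewrite cE rmorphM /= zE !mxE mulrA -pmulrn.
Qed.

Lemma proj_dim2 : proj_dim X 2.
Proof.
split.
  exists [set base i | i : 'I_3]; first exact: base_alg_independent.
  by rewrite card_imset ?card_ord //; exact: base_inj.
(* A relation supported on [A] gives a nonzero vanishing binomial in the coordinates of [A]. *)
move=> A indA; rewrite leqNgt; apply/negP => /int_relation[c [cA [j cj] c0]].
have cAN k : k \notin A -> pos_part c k = 0%N /\ pos_part (fun k => - c k) k = 0%N.
  by move=> kA; rewrite !mnmE !cA // oppr0 lexx.
have supp_F m : m \in msupp ('X_[pos_part c] - 'X_[K, pos_part (fun k => - c k)]) ->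
    forall k, k \notin A -> m k = 0%N.
  by move=> /msuppB_le; rewrite mem_cat => /orP[] /mem_msuppXP <- k /cAN[].
have /eqP := indA _ supp_F (binomial_vanishing (weight_pos_part c0)).
rewrite subr_eq0 => /eqP/mpolyP/(_ (pos_part c)).
rewrite !mcoeffX eqxx; case: eqP => [eqc _|_ /eqP]; last by rewrite oner_eq0.
by case/negP: cj; rewrite -pos_partB -eqc subrr.
Qed.

Lemma mderivX_eval b k P : P k != 0 ->
  (('X_[b] : {mpoly K[N]})^`M(k)).@[P] = (b k)%:R * ('X_[b]).@[P] / P k.
Proof.
move=> Pk; rewrite mderivX mevalZ; case: (posnP (b k)) => [->|bk].
  by rewrite !mul0r.
have le_kb : (U_(k) <= b)%MM.
  by apply/mnm_lepP => i; rewrite mnm1E; case: eqP => // <-.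
have -> : ('X_[b] : {mpoly K[N]}).@[P] = ('X_[b - U_(k)]).@[P] * P k.
  by rewrite -{1}(submK le_kb) mpolyXD mevalM mevalXU.
by rewrite mulrA mulfK.
Qed.

(** The two terms of the binomial of [c] have the same nonzero value at [P]; dividing its
    differential by this value leaves the logarithmic derivative. *)
Lemma tangent_relation P (u : 'rV[K]_N) c : X P -> (forall j, P j != 0) ->
    (forall F, vanishing_forms X F -> \sum_j (F^`M(j)).@[P] * u 0 j = 0) ->
    (forall v, \sum_j c j * (mm j v)%:Z = 0) ->
  \sum_j (c j)%:~R * (u 0 j / P j) = 0.
Proof.
move=> XP P0 tan_u c0; have vF := binomial_vanishing (weight_pos_part c0).
set b1 := pos_part c in vF; set b2 := pos_part _ in vF.
have eqP12 : ('X_[b2] : {mpoly K[N]}).@[P] = 'X_[b1].@[P].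
  by case: vF => _ /(_ _ XP); rewrite mevalB => /eqP; rewrite subr_eq0 => /eqP.
have nzP : ('X_[b1] : {mpoly K[N]}).@[P] != 0.
  by rewrite mevalX; apply/prodf_neq0 => j _; rewrite expf_neq0.
apply: (mulfI nzP); rewrite mulr0 -[RHS](tan_u _ vF) mulr_sumr.
apply: eq_bigr => j _; rewrite mderivB mevalB !mderivX_eval // eqP12.
rewrite -(pos_partB c j) rmorphB /= -!pmulrn; ring.
Qed.

(** Row [v] is the derivative at t = 1 of the orbit t.P with respect to t_v. *)
Definition tangent_mx P : 'M[K]_(3, N) := \matrix_(v, j) (P j * (mm j v)%:R).

Lemma base_mx_inj (y : 'I_3 -> K) :
  (forall i, \sum_v (mm (base i) v)%:R * y v = 0) -> forall v, y v = 0.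
Proof.
move=> y0 v; have : base_mx *m (\col_v y v) = 0.
  apply/colP => i; rewrite !mxE -[RHS](y0 i); apply: eq_bigr => w _.
  by rewrite !mxE.
move/(congr1 (mulmx (invmx base_mx))); rewrite mulKmx ?base_mx_unit // mulmx0.
by move/colP/(_ v); rewrite !mxE.
Qed.

Lemma tangent_row_free P : (forall j, P j != 0) -> row_free (tangent_mx P).
Proof.
move=> P0; rewrite -kermx_eq0; apply/rowV0P => y /sub_kermxP yT.
apply/rowP => v; rewrite mxE; apply: (base_mx_inj (y := fun v => y 0 v)) => i.
move/rowP/(_ (base i)): yT; rewrite !mxE => yT; apply: (mulfI (P0 (base i))).
rewrite mulr0 -[RHS]yT mulr_sumr; apply: eq_bigr => w _; rewrite mxE; ring.
Qed.

(** Differentiate at t = 1 the identity F(t.P) = 0 given by [orbit_poly0]. *)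
Lemma euler_tangent P F v : X P -> (forall j, P j != 0) -> vanishing_forms X F ->
  \sum_j (F^`M(j)).@[P] * (P j * (mm j v)%:R) = 0.
Proof.
move=> XP P0 vF; have := orbit_poly0 XP vF.
move/(congr1 (fun p => (p^`M(v)).@[fun=> 1])); rewrite mderiv0 meval0 => orb0.
rewrite -[RHS]orb0 /orbit_poly [X in meval _ X]raddf_sum [RHS]raddf_sum /=.
under [RHS]eq_bigr do rewrite mderivZ mevalZ mderivX mevalZ mevalX.
transitivity (\sum_(b <- msupp F) \sum_j
    F@_b * (('X_[b])^`M(j)).@[P] * (P j * (mm j v)%:R)).
  rewrite [RHS]exchange_big; apply: eq_bigr => j _ /=; rewrite -mulr_suml {1}[F]mpolyE.
  rewrite [X in meval _ X]raddf_sum [X in X * _]raddf_sum /=; congr *%R.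
  apply: eq_bigr => b _.
  by rewrite mderivZ mevalZ.
apply: eq_bigr => b _; rewrite [\prod_(i < 3) _]big1 => [|w _]; last exact: expr1n.
rewrite mulr1 -mulrA weightE natr_sum !mulr_sumr; apply: eq_bigr => j _.
rewrite mderivX_eval // mevalX natrM; field; exact: P0.
Qed.

(** Orbit directions are tangent by [euler_tangent]. Conversely, subtract from [u] the orbit
    direction agreeing with it at the base coordinates: the rest vanishes there, and the binomial of
    an integral relation ties every other coordinate to these. *)
Lemma tangent_spaceP P (u : 'rV[K]_N) : X P -> (forall j, P j != 0) ->
  (u <= tangent_mx P)%MS <->
  (forall F, vanishing_forms X F -> \sum_j (F^`M(j)).@[P] * u 0 j = 0).
Proof.
move=> XP P0; split=> [/submxP[y ->] F vF|tan_u].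
  under eq_bigr do rewrite mxE mulr_sumr.
  rewrite exchange_big big1 // => v _ /=.
  under eq_bigr do rewrite mxE mulrCA.
  by rewrite -mulr_sumr euler_tangent // mulr0.
have [y Dy] : exists y, base_mx *m y = \col_i (u 0 (base i) / P (base i)).
  by exists (invmx base_mx *m \col_i (u 0 (base i) / P (base i)));
     rewrite mulKVmx ?base_mx_unit.
pose u' := u - y^T *m tangent_mx P.
have u'E j : u' 0 j / P j = u 0 j / P j - \sum_v (mm j v)%:R * y v 0.
  rewrite !mxE mulrBl; congr (_ - _); rewrite mulr_suml; apply: eq_bigr => v _.
  by rewrite !mxE; field; exact: P0.
have u'base i : u' 0 (base i) / P (base i) = 0.
  rewrite u'E; have -> : \sum_v (mm (base i) v)%:R * y v 0 = (base_mx *m y) i 0.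
    by rewrite mxE; apply: eq_bigr => v _; rewrite mxE.
  by rewrite Dy mxE subrr.
have tan_u' F : vanishing_forms X F -> \sum_j (F^`M(j)).@[P] * u' 0 j = 0.
  move=> vF; under eq_bigr do rewrite !mxE mulrBr.
  rewrite sumrB tan_u // sub0r; apply/eqP; rewrite oppr_eq0; apply/eqP.
  under eq_bigr do rewrite mulr_sumr.
  rewrite exchange_big big1 // => v _ /=.
  under eq_bigr do rewrite [tangent_mx _ _ _]mxE mulrCA.
  by rewrite -mulr_sumr euler_tangent // mulr0.
suff u'0 : u' = 0 by move/eqP: u'0; rewrite subr_eq0 => /eqP->; exact: submxMl.
apply/rowP => j; rewrite [RHS]mxE.
have [D [C [D0 DC]]] := base_relation j.
(* The coefficients of the relation between [mm j] and the base exponents; indicator functions also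
   cover a [j] that belongs to the base. *)
pose c k := D * (k == j)%:Z - \sum_i C i * (k == base i)%:Z.
have pick (R : comNzRingType) (l : 'I_N) (g : 'I_N -> R) :
    \sum_k (k == l)%:R * g k = g l.
  by rewrite (bigD1 l) //= eqxx mul1r big1 ?addr0 // => k /negbTE->; rewrite mul0r.
have c_sum (R : comNzRingType) (g : 'I_N -> R) : \sum_k (c k)%:~R * g k =
    D%:~R * g j - \sum_i (C i)%:~R * g (base i).
  rewrite -[g j](pick R j g) mulr_sumr.
  under [X in _ = _ - X]eq_bigr => i _ do rewrite -(pick R (base i) g) mulr_sumr.
  rewrite [X in _ = _ - X]exchange_big -sumrB; apply: eq_bigr => k _ /=.
  rewrite /c rmorphB rmorphM rmorph_sum /= mulrBl mulr_suml -!pmulrn mulrA.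
  by congr (_ - _); apply: eq_bigr => i _; rewrite rmorphM /= -pmulrn mulrA.
have c0 v : \sum_k c k * (mm k v)%:Z = 0.
  have := c_sum int (fun k => (mm k v)%:Z).
  under eq_bigr do rewrite intz; rewrite intz DC => ->.
  by apply/eqP; rewrite subr_eq0; apply/eqP; apply: eq_bigr => i _; rewrite intz.
have := tangent_relation XP P0 tan_u' c0; rewrite c_sum big1 ?subr0; last first.
  by move=> i _; rewrite u'base mulr0.
move/eqP; rewrite mulf_eq0 (negbTE (pchar0_intr_neq0 charK D0)) /=.
by rewrite mulf_eq0 invr_eq0 (negbTE (P0 j)) orbF => /eqP.
Qed.

Lemma smooth_point_torus P : X P -> (forall j, P j != 0) -> smooth_point X 2 P.
Proof.
move=> XP P0; split=> //; exists (tangent_mx P); first exact: tangent_row_free.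
by move=> u; exact: tangent_spaceP.
Qed.

End Toric.

(** * The orbit map as a local parametrisation *)

Section TruncatedSeries.
Variables (K : fieldType) (n k : nat).
Implicit Types p q : {mpoly K[n]}.

(** Congruence modulo terms of degree above [k], under which power series may be replaced by
    truncations. *)
Definition eq_upto p q := forall a : 'X_{1..n}, (mdeg a <= k)%N -> p@_a = q@_a.

Lemma eq_upto_trans p q r : eq_upto p q -> eq_upto q r -> eq_upto p r.
Proof. by move=> pq qr a ka; rewrite pq ?qr. Qed.

Lemma eq_uptoM p p' q q' : eq_upto p p' -> eq_upto q q' -> eq_upto (p * q) (p' * q').
Proof.
move=> pp qq a ka; rewrite !mcoeffM; apply: eq_bigr => -[x y] /= /eqP Da.
have := congr1 (@mdeg n) Da; rewrite mdegD => Ea.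
by rewrite pp ?qq //; lia.
Qed.

Lemma eq_uptoX p q m : eq_upto p q -> eq_upto (p ^+ m) (q ^+ m).
Proof. by move=> pq; elim: m => [//|m IHm]; rewrite !exprS; exact: eq_uptoM. Qed.

Lemma eq_upto_prod (I : finType) (F G : I -> {mpoly K[n]}) :
  (forall i, eq_upto (F i) (G i)) -> eq_upto (\prod_i F i) (\prod_i G i).
Proof. by move=> FG; elim/big_rec2: _ => // i p q _; exact: eq_uptoM. Qed.

Lemma eq_upto_comp N (F : {mpoly K[N]}) (s t : N.-tuple {mpoly K[n]}) :
  (forall j, eq_upto (tnth s j) (tnth t j)) -> eq_upto (F \mPo s) (F \mPo t).
Proof.
move=> st a ka; rewrite !comp_mpolyEX !raddf_sum; apply: eq_bigr => b _ /=.
rewrite !mcoeffZ !comp_mpolyX; congr *%R.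
by apply: eq_upto_prod ka => j; exact: eq_uptoX.
Qed.

End TruncatedSeries.

(** * Binomial series with arbitrary exponents *)

Section BinomialSeries.
Variables (K : fieldType) (charK : [pchar K] =i pred0).

Definition fall (x : K) (k : nat) : K := \prod_(i < k) (x - i%:R).

Lemma fallS x k : fall x k.+1 = fall x k * (x - k%:R).
Proof. by rewrite /fall big_ord_recr. Qed.

Lemma fall0 x : fall x 0 = 1. Proof. exact: big_ord0. Qed.

Lemma fall_shift x k : fall (x + 1) k.+1 = (x + 1) * fall x k.
Proof.
elim: k => [|k IHk]; first by rewrite fallS !fall0 mul1r subr0 mulr1.
by rewrite fallS IHk fallS -addn1 natrD; ring.
Qed.

(** Generalised binomial coefficient: [x] will be a difference of exponents, possibly negative. *)
Definition gbin (x : K) (k : nat) : K := fall x k / (k`!)%:R.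

Lemma fact_neq0 k : (k`!)%:R != 0 :> K.
Proof. by rewrite pchar0_natr_neq0 ?fact_gt0. Qed.

Lemma gbin0 x : gbin x 0 = 1. Proof. by rewrite /gbin fall0 divr1. Qed.

Lemma gbin_pascal x k : gbin (x + 1) k.+1 = gbin x k.+1 + gbin x k.
Proof.
rewrite /gbin fall_shift fallS factS natrM -addn1 natrD.
have := fact_neq0 k; have := pchar0_natr_neq0 charK (ltn0Sn k).
by rewrite -addn1 natrD => ? ?; field; apply/andP; split.
Qed.

Lemma gbin_0S k : gbin 0 k.+1 = 0.
Proof. by rewrite /gbin /fall big_ord_recl subrr !mul0r. Qed.

Variable n : nat.
Implicit Types (x : 'I_n -> K) (a : 'X_{1..n}).

(** The coefficient of t^a in the series prod_i (1 + t_i)^(x_i). *)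
Definition binom_coef x a : K := \prod_i gbin (x i) (a i).

Definition binom_trunc k x : {mpoly K[n]} :=
  \sum_(a : 'X_{1..n < k.+1}) binom_coef x a *: 'X_[a].

Lemma mcoeff_trunc (g : 'X_{1..n} -> K) k a :
  (\sum_(b : 'X_{1..n < k.+1}) g b *: 'X_[b])@_a = if (mdeg a <= k)%N then g a else 0.
Proof.
case: ifPn => ka; last first.
  rewrite raddf_sum big1 //= => b _; rewrite mcoeffZ mcoeffX; case: eqP => [eqb|].
    by rewrite -eqb -ltnS bmdeg in ka.
  by rewrite mulr0.
rewrite -ltnS in ka; rewrite raddf_sum (bigD1 (BMultinom ka)) //= mcoeffZ mcoeffX.
rewrite eqxx mulr1 big1 ?addr0 // => b /negbTE neb.
by rewrite mcoeffZ mcoeffX -[a]/(bmnm (BMultinom ka)) -bmeqP neb mulr0.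
Qed.

(** Pascal's rule in the [i]-th factor, read as multiplication of the series by 1 + t_i. *)
Lemma binom_trunc_shift1 k x i :
  eq_upto k (binom_trunc k (fun l => x l + (l == i)%:R)) ((1 + 'X_i) * binom_trunc k x).
Proof.
move=> a ka; rewrite mulrDl mul1r mcoeffD mulrC mcoeffMXE !mcoeff_trunc ka.
have others (b : 'X_{1..n}) (y : 'I_n -> K) : (forall l, l != i -> b l = a l /\ y l = x l) ->
    binom_coef y b = gbin (y i) (b i) * \prod_(l | l != i) gbin (x l) (a l).
  move=> eqb; rewrite /binom_coef (bigD1 i) //=; congr *%R; apply: eq_bigr => l.
  by case/eqb => -> ->.
rewrite (others a) => [|l /negbTE->]; last by rewrite addr0.
rewrite (others a x) // eqxx; case: ifPn => [le_ia|/mnm_lepP nle].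
  have ai : (0 < a i)%N by have /mnm_lepP/(_ i) := le_ia; rewrite mnm1E eqxx.
  rewrite (leq_trans (mdegB _ _) ka) (others (a - U_(i))%MM x) => [|l nel]; last first.
    by rewrite mnmBE mnm1E eq_sym (negbTE nel) subn0.
  rewrite mnmBE mnm1E eqxx -mulrDl; congr *%R.
  by rewrite -(prednK ai) subn1 /= gbin_pascal.
suff -> : a i = 0%N by rewrite !gbin0 addr0.
apply/eqP; rewrite -leqn0 leqNgt; apply/negP => ai; case: nle => l.
by rewrite mnm1E; case: eqP => // <-.
Qed.

Definition one_plus (m : 'I_n -> nat) : {mpoly K[n]} := \prod_i (1 + 'X_i) ^+ m i.

(** Natural shifts suffice later, because every m_j - m_c is reached from the common exponent
    -m_c. *)
Lemma binom_trunc_shift k x m :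
  eq_upto k (binom_trunc k (fun i => x i + (m i)%:R)) (one_plus m * binom_trunc k x).
Proof.
have [M ltM] := ubnP (\sum_i m i)%N; elim: M m ltM => // M IHM m.
rewrite ltnS => le_mM; have [i mi|m0] := pickP (fun i => m i != 0%N); last first.
  have m0' i : m i = 0%N by apply/eqP/negbFE/m0.
  rewrite /one_plus big1 => [|i _]; last by rewrite m0'.
  rewrite mul1r => a _; congr mcoeff; apply: eq_bigr => b _; congr (_ *: _).
  by apply: eq_bigr => i _; rewrite m0' addr0.
pose m' l := (m l - (l == i))%N.
have mE l : m l = (m' l + (l == i))%N.
  by rewrite /m' subnK //; case: eqP => // ->; rewrite lt0n.
have lt_m' : (\sum_i m' i < M)%N.
  apply: leq_trans le_mM; rewrite (bigD1 i) //= [X in (_ < X)%N](bigD1 i) //= mE eqxx.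
  rewrite addn1 ltnS leq_add2l; apply: leq_sum => l _; exact: leq_subr.
have -> : one_plus m = (1 + 'X_i) * one_plus m'.
  rewrite /one_plus (bigD1 i) //= [X in _ = _ * X](bigD1 i) //= mE eqxx addn1 exprS.
  rewrite mulrA; congr *%R; apply: eq_bigr => l /negbTE nel.
  by rewrite mE nel addn0.
have -> : (fun i => x i + (m i)%:R) = (fun l => (x l + (m' l)%:R) + (l == i)%:R).
  by apply/funext => l; rewrite mE natrD addrA.
refine (eq_upto_trans (@binom_trunc_shift1 k (fun l => x l + (m' l)%:R) i) _).
by rewrite -mulrA; refine (eq_uptoM _ _) => //; exact: IHM.
Qed.

Lemma binom_trunc0 k : eq_upto k (binom_trunc k (fun=> 0)) 1.
Proof.
move=> a ka; rewrite mcoeff_trunc ka mcoeff1.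
have [->|nea] := eqVneq a 0%MM.
  by rewrite /binom_coef big1 // => i _; rewrite mnm0E gbin0.
have [i ai] : exists i, a i != 0%N.
  apply: contrapT => a0; case/negP: nea; apply/eqP/mnmP => i; rewrite mnm0E.
  by apply: contrapT => /eqP ai; apply: a0; exists i.
by rewrite /binom_coef (bigD1 i) //=; case: (a i) ai => // l _; rewrite gbin_0S mul0r.
Qed.

End BinomialSeries.

Section LocalParametrization.
Variables (K : fieldType) (charK : [pchar K] =i pred0).
Variables (N d : nat) (mm : 'I_N -> 'X_{1..3}) (f : N.-tuple {mpoly K[3]}).
Hypotheses (d_gt0 : (0 < d)%N) (mm_deg : forall j, mdeg (mm j) = d).
Hypothesis fE : forall j, tnth f j = 'X_[mm j].
Variable base : 'I_3 -> 'I_N.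
Hypothesis base_det :
  \det (\matrix_(i < 3, v < 3) (mm (base i) v)%:Z : 'M[int]_3) != 0.
Variables (P : 'I_N -> K) (c : 'I_N).
Hypotheses (XP : image_closure f P) (P0 : forall j, P j != 0).

Definition coord (i : 'I_2) : 'I_3 := widen_ord (leqnSn 2) i.

Definition rel_exponent (j : 'I_N) (i : 'I_2) : K :=
  (mm j (coord i))%:R - (mm c (coord i))%:R.

(* The expansion of t |-> (t^(mm j - mm c) P_j / P_c)_j at t = (1 + s_0, 1 + s_1, 1). *)
Definition torus_param : fps_vector K N 2 :=
  fun j a => P j / P c * binom_coef (rel_exponent j) a.

(** The point (1 + s_0, 1 + s_1, 1): no [coord i] is the last variable, so the last entry is 1. *)
Definition one_plus_vars (v : 'I_3) : {mpoly K[2]} :=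
  \prod_(i < 2) (1 + 'X_i) ^+ (coord i == v).

Lemma one_plusE (m : 'X_{1..3}) :
  one_plus K (fun i : 'I_2 => m (coord i)) = \prod_v one_plus_vars v ^+ m v.
Proof.
rewrite /one_plus_vars; under [RHS]eq_bigr do rewrite -prodrXl.
rewrite exchange_big; apply: eq_bigr => i _ /=.
rewrite (bigD1 (coord i)) //= eqxx expr1 big1 ?mulr1 // => v /negbTE nev.
by rewrite eq_sym nev expr0 expr1n.
Qed.

(** Up to the needed degree the parametrisation is R / P_c times the orbit of [P] at (1 + s_0, 1 +
    s_1, 1), where [R] truncates (1 + s)^(-m_c). Homogeneity of [F] takes out the common factor and
    leaves [orbit_poly], which is zero. *)
Lemma torus_param_zero F : vanishing_forms (image_closure f) F ->
  fps_zero F torus_param.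
Proof.
move=> vF a; set k := mdeg a; have [[l Fl] _] := vF.
pose R := binom_trunc k (fun i : 'I_2 => - (mm c (coord i))%:R : K).
pose t := [tuple (P c)^-1 *: R * (P j *: \prod_v one_plus_vars v ^+ mm j v) | j < N].
have -> : (F \mPo fps_trunc torus_param k)@_a = (F \mPo t)@_a.
  apply: (@eq_upto_comp _ _ k) => // j b kb; rewrite !tnth_mktuple.
  rewrite mcoeff_trunc kb /torus_param.
  have := @binom_trunc_shift K charK 2 k (fun i => - (mm c (coord i))%:R)
    (fun i => mm j (coord i)) b kb.
  rewrite mcoeff_trunc kb one_plusE => /(congr1 ( *%R (P j / P c))).
  rewrite -mcoeffZ -/R => eqb.
  transitivity ((P j / P c) *: (\prod_v one_plus_vars v ^+ mm j v * R))@_b.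
    rewrite -eqb; congr *%R; apply: eq_bigr => i _; congr gbin.
    by rewrite /rel_exponent addrC.
  congr mcoeff; rewrite -[RHS]scalerAl -[X in _ = _ *: X]scalerAr scalerA.
  by rewrite [R * _]mulrC [_^-1 * _]mulrC.
suff -> : F \mPo t = 0 by rewrite mcoeff0.
transitivity (((P c)^-1 *: R) ^+ l *
    (orbit_poly mm P F \mPo [tuple one_plus_vars v | v < 3])); last first.
  by rewrite (orbit_poly0 charK fE XP vF) comp_mpoly0 mulr0.
rewrite [F \mPo t]comp_mpolyEX /orbit_poly [X in _ = _ * X]raddf_sum.
rewrite [RHS]mulr_sumr [LHS]big_seq [RHS]big_seq.
apply: eq_bigr => b Fb /=; rewrite !comp_mpolyZ !comp_mpolyX.
transitivity (F@_b *: (((P c)^-1 *: R) ^+ l *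
    ((\prod_j P j ^+ b j)%:MP * \prod_v one_plus_vars v ^+ weight mm b v))).
  congr (_ *: _).
  have -> : (\prod_j P j ^+ b j)%:MP_[2] = \prod_j (P j)%:MP_[2] ^+ b j.
    by rewrite rmorph_prod; apply: eq_bigr => j _; rewrite rmorphXn.
  have <- : mdeg b = l by exact: (dhomog_mf Fl Fb).
  rewrite -prod_scaleX mdegE expr_sum -big_split.
  by apply: eq_bigr => j _; rewrite /= tnth_mktuple -exprMn mul_mpolyC.
rewrite mul_mpolyC -[X in _ *: X = _]scalerAr scalerA -[RHS]scalerAr.
by congr (_ *: (_ * _)); apply: eq_bigr => v _; rewrite tnth_mktuple.
Qed.

Lemma fps_deriv_torus a : fps_deriv torus_param a =
  \row_j (P j / P c * \prod_i fall (rel_exponent j i) (a i)).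
Proof.
apply/rowP => j; rewrite !mxE /torus_param mulrCA; congr *%R.
rewrite natr_prod -big_split; apply: eq_bigr => i _ /=.
by rewrite /gbin mulrCA divff ?mulr1 ?fact_neq0.
Qed.

Lemma fall_U (x : 'I_2 -> K) (i : 'I_2) : \prod_l fall (x l) (U_(i)%MM l) = x i.
Proof.
rewrite (bigD1 i) //= mnm1E eqxx big1 => [|l /negbTE nel].
  by rewrite mulr1 fallS fall0 mul1r subr0.
by rewrite mnm1E eq_sym nel fall0.
Qed.

Lemma sum_coord (R : nzRingType) (g : 'I_3 -> R) :
  \sum_v g v = \sum_i g (coord i) + g ord_max.
Proof. by rewrite big_ord_recr. Qed.

Lemma local_param_torus : local_param (image_closure f) P torus_param.
Proof.
split; last 2 first.
- exact: torus_param_zero.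
- rewrite -kermx_eq0; apply/rowV0P => y /sub_kermxP yJ.
  have y_rel j : \sum_i y 0 i * rel_exponent j i = 0.
    apply: (mulfI (P0 j)); apply: (mulfI (invr_neq0 (P0 c))); rewrite !mulr0.
    move/rowP/(_ j): yJ; rewrite mxE [RHS]mxE => yJ; rewrite -[RHS]yJ.
    rewrite !mulr_sumr; apply: eq_bigr => i _.
    by rewrite mxE fps_deriv_torus mxE fall_U; ring.
  (* As the exponents of each [mm j] sum to [d], extending [y] by zero and subtracting k / d from
     every entry makes the affine relation [y_rel] linear; invertibility of the base matrix then
     gives z = 0. *)
  pose k := \sum_i y 0 i * (mm c (coord i))%:R.
  have d0 : d%:R != 0 :> K by exact: pchar0_natr_neq0.
  pose z (v : 'I_3) := - (k / d%:R) + (if insub (v : nat) is Some i then y 0 i else 0).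
  have zc i : z (coord i) = - (k / d%:R) + y 0 i by rewrite /z valK.
  have zm : z ord_max = - (k / d%:R) by rewrite /z insubF ?addr0.
  have z0 : forall v, z v = 0.
    apply: (base_mx_inj charK base_det) => i.
    have deg_sum : \sum_v (mm (base i) v)%:R = d%:R :> K.
      by rewrite -(mm_deg (base i)) mdegE natr_sum.
    transitivity (\sum_l (mm (base i) (coord l))%:R * y 0 l
        - k / d%:R * \sum_v (mm (base i) v)%:R).
      rewrite !sum_coord zm mulrDr opprD addrA mulr_sumr -sumrB.
      rewrite [_ * - _]mulrN [_%:R * (k / _)]mulrC; congr (_ - _).
      by apply: eq_bigr => l _; rewrite zc; ring.
    rewrite deg_sum divfK // -[RHS](y_rel (base i)) -sumrB.
    by apply: eq_bigr => l _; rewrite /rel_exponent; ring.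
  apply/rowP => i; rewrite mxE; have := z0 (coord i); have := z0 ord_max.
  by rewrite zm zc => ->; rewrite add0r.
exists c; split=> // [a|j]; rewrite /torus_param.
  rewrite divff // mul1r; have [b|] := eqVneq a 0%MM.
    by rewrite b /binom_coef big1 // => i _; rewrite mnm0E gbin0.
  (* At [c] the relative exponents vanish, and the series is the constant 1. *)
  move=> nea; have := @binom_trunc0 K 2 (mdeg a) a (leqnn _).
  rewrite mcoeff_trunc leqnn mcoeff1 (negbTE nea) => <-.
  by apply: eq_bigr => i _; rewrite /rel_exponent subrr.
by rewrite /binom_coef big1 ?mulr1 // => i _; rewrite mnm0E gbin0.
Qed.

End LocalParametrization.

(** * Osculating spaces and falling factorials *)

Lemma dim_rowspace (K : fieldType) m N (M : 'M[K]_(m, N)) (V : {vspace 'rV[K]_N}) :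
  (forall u, (u \in V) = (u <= M)%MS) -> \dim V = \rank M.
Proof.
move=> VM; pose X := [tuple row i (row_base M) | i < \rank M].
suff bX : basis_of V X by exact: (vector.size_basis bX).
apply/andP; split; last first.
  apply/freeP => k k0; have rf := row_base_free M.
  suff /rowP kr : \row_i k i = 0 by move=> i; have := kr i; rewrite !mxE.
  apply: (row_free_inj rf); rewrite /= mul0mx mulmx_sum_row -[RHS]k0.
  by apply: eq_bigr => i _; rewrite mxE -tnth_nth tnth_mktuple.
rewrite eqEsubv; apply/andP; split.
  apply/span_subvP => _ /mapP[i _ ->].
  by rewrite VM (submx_trans (row_sub _ _)) // eq_row_base.
apply/subvP => u; rewrite VM -(eq_row_base M) => /submxP[y ->].
rewrite mulmx_sum_row; apply: rpred_sum => i _; apply: rpredZ.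
by apply: memv_span; apply/mapP; exists i; rewrite ?mem_enum.
Qed.

Lemma span_mulmx (K : fieldType) m N (X : seq 'rV[K]_m) (D : 'M[K]_(m, N))
    (V : {vspace 'rV[K]_N}) :
  (forall x, x \in X -> x *m D \in V) -> forall u, u \in <<X>>%VS -> u *m D \in V.
Proof.
move=> XV u uX; rewrite (coord_span (X := in_tuple X) uX) mulmx_suml.
apply: rpred_sum => i _; rewrite -scalemxAl; apply: rpredZ; apply: XV.
exact: mem_nth.
Qed.

Lemma mdegS_ex n (a : 'X_{1..n}) k : mdeg a = k.+1 ->
  exists i b, a = (b + U_(i))%MM /\ mdeg b = k.
Proof.
move=> dega; have [i ai] : exists i, a i != 0%N.
  apply: contrapT => a0; move: dega; rewrite mdegE big1 // => i _.
  by apply: contrapT => /eqP ai; apply: a0; exists i.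
exists i, (a - U_(i))%MM; have Da : a = (a - U_(i) + U_(i))%MM.
  rewrite submK //; apply/mnm_lepP => j; rewrite mnm1E.
  by case: eqP => // <-; rewrite lt0n.
by split=> //; move: dega; rewrite {1}Da mdegD mdeg1 addn1 => -[].
Qed.

Section FallingSpans.
Variables (K : fieldType) (charK : [pchar K] =i pred0) (N : nat) (w : 'I_N -> K).

Definition fall_row n (x : 'I_N -> 'I_n -> K) (a : 'X_{1..n}) : 'rV[K]_N :=
  \row_j (w j * \prod_i fall (x j i) (a i)).

(** Falling monomials of degree at most [k] span the polynomials of degree at most [k], so this is
    the space of weighted values of such polynomials at the points [x j]. *)
Definition fall_span n (x : 'I_N -> 'I_n -> K) k : {vspace 'rV[K]_N} :=
  <<[seq fall_row x (bmnm a) | a : 'X_{1..n < k.+1}]>>%VS.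

Definition mul_diag (g : 'I_N -> K) (u : 'rV[K]_N) := u *m diag_mx (\row_j g j).

Lemma mul_diagE g u : mul_diag g u = \row_j (u 0 j * g j).
Proof. by apply/rowP => j; rewrite /mul_diag mul_mx_diag !mxE. Qed.

Lemma fall_rowS n (x : 'I_N -> 'I_n -> K) a i :
  fall_row x (a + U_(i))%MM = mul_diag (fun j => x j i - (a i)%:R) (fall_row x a).
Proof.
rewrite mul_diagE; apply/rowP => j; rewrite !mxE -mulrA; congr *%R.
rewrite (bigD1 i) //= [in RHS](bigD1 i) //= mnmDE mnm1E eqxx addn1 fallS.
rewrite mulrAC; congr (_ * _ * _); apply: eq_bigr => l /negbTE nel.
by rewrite mnmDE mnm1E eq_sym nel addn0.
Qed.

Lemma fall_row_in n (x : 'I_N -> 'I_n -> K) a k : (mdeg a <= k)%N ->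
  fall_row x a \in fall_span x k.
Proof.
rewrite -ltnS => ka; apply: memv_span; apply/mapP.
by exists (BMultinom ka : 'X_{1..n < k.+1}); rewrite ?mem_enum.
Qed.

Lemma fall_spanP n (x : 'I_N -> 'I_n -> K) k (V : {vspace 'rV[K]_N}) :
  (forall a, (mdeg a <= k)%N -> fall_row x a \in V) -> (fall_span x k <= V)%VS.
Proof.
move=> xV; apply/span_subvP => _ /mapP[a _ ->]; apply: xV.
by rewrite -ltnS bmdeg.
Qed.

(** From x (x)_k = (x)_(k+1) + k (x)_k in the [i]-th variable. *)
Lemma fall_span_mul n (x : 'I_N -> 'I_n -> K) k i u : u \in fall_span x k ->
  mul_diag (fun j => x j i) u \in fall_span x k.+1.
Proof.
apply: span_mulmx => _ /mapP[a _ ->]; rewrite -/(mul_diag _ _).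
have -> : mul_diag (fun j => x j i) (fall_row x a) =
    fall_row x (a + U_(i))%MM + (bmnm a i)%:R *: fall_row x a.
  rewrite fall_rowS !mul_diagE; apply/rowP => j; rewrite !mxE; ring.
have := bmdeg a; rewrite ltnS => ka.
by rewrite rpredD ?rpredZ // fall_row_in ?mdegD ?mdeg1 ?addn1 // ltnW.
Qed.

Definition affine_in n (x : 'I_N -> 'I_n -> K) (g : 'I_N -> K) :=
  exists (c0 : K) (c : 'I_n -> K), forall j, g j = c0 + \sum_i c i * x j i.

Lemma fall_span_affine n (x : 'I_N -> 'I_n -> K) g k u : affine_in x g ->
  u \in fall_span x k -> mul_diag g u \in fall_span x k.+1.
Proof.
move=> [c0 [c gE]] ux.
have -> : mul_diag g u = c0 *: u + \sum_i c i *: mul_diag (fun j => x j i) u.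
  apply/rowP => j; rewrite mul_diagE !mxE summxE gE mulrDr mulrC mulr_sumr.
  by congr (_ + _); apply: eq_bigr => i _; rewrite mul_diagE !mxE; ring.
apply: rpredD; last first.
  by apply: rpred_sum => i _; apply: rpredZ; exact: fall_span_mul.
apply: rpredZ; move: u ux; apply/subvP/fall_spanP => a ka.
by apply: fall_row_in; exact: leqW.
Qed.

(** Affine substitutions do not raise the degree: induction, one linear factor at a time. *)
Lemma fall_span_change n m (x : 'I_N -> 'I_n -> K) (y : 'I_N -> 'I_m -> K) k :
  (forall i, affine_in x (fun j => y j i)) -> (fall_span y k <= fall_span x k)%VS.
Proof.
move=> yx; apply: fall_spanP => a ka.
suff h l b : mdeg b = l -> fall_row y b \in fall_span x l.
  move: (fall_row y a) (h _ a erefl); apply/subvP/fall_spanP => b kb.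
  by apply: fall_row_in; exact: leq_trans ka.
elim: l b => [b /eqP|l IHl b /mdegS_ex[i [b' [-> db']]]].
  rewrite mdeg_eq0 => /eqP->; rewrite (_ : fall_row y 0 = fall_row x 0).
    by apply: fall_row_in; rewrite mdeg0.
  by apply/rowP => j; rewrite !mxE !big1 // => i _; rewrite mnm0E fall0.
rewrite fall_rowS; apply: fall_span_affine; last exact: IHl.
have [c0 [c yE]] := yx i; exists (c0 - (b' i)%:R), c => j.
by rewrite yE addrAC.
Qed.

(* The analogue for falling factorials of Euler's identity
   sum_i x_i d/dx_i = degree. *)
Lemma fall_row_euler n (x : 'I_N -> 'I_n -> K) d a :
    (forall j, \sum_i x j i = d%:R) -> (mdeg a <= d)%N ->
  \sum_i fall_row x (a + U_(i))%MM = (d - mdeg a)%:R *: fall_row x a.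
Proof.
move=> xd ad; apply/rowP => j; rewrite summxE.
under eq_bigr do rewrite fall_rowS mul_diagE mxE.
by rewrite -mulr_sumr sumrB xd -natr_sum -mdegE -natrB // !mxE mulrC.
Qed.

(** Descending induction on the degree k of a row: Euler's identity expresses it through rows of
    degree k + 1, after division by d + 1 - k, which is positive for k at most [d]. *)
Lemma fall_span_top n (x : 'I_N -> 'I_n -> K) d (V : {vspace 'rV[K]_N}) :
    (forall j, \sum_i x j i = d.+1%:R) ->
    (forall a, mdeg a = d -> fall_row x a \in V) ->
  (fall_span x d <= V)%VS.
Proof.
move=> xd topV; apply: fall_spanP => a.
have [k] := ubnP (d - mdeg a); elim: k a => // k IHk a; rewrite ltnS => le_k le_d.
have [eqd|ned] := eqVneq (mdeg a) d; first exact: topV.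
have d0 : (d.+1 - mdeg a)%:R != 0 :> K by rewrite pchar0_natr_neq0 // subn_gt0 ltnS.
rewrite -[fall_row x a](scalerK d0) -(fall_row_euler xd (leqW le_d)).
apply: rpredZ; apply: rpred_sum => i _; apply: IHk; rewrite mdegD mdeg1; lia.
Qed.

End FallingSpans.

Section OsculatingRank.
Variables (K : fieldType) (charK : [pchar K] =i pred0).
Variables (N d : nat) (mm : 'I_N -> 'X_{1..3}) (w : 'I_N -> K) (T : set 'X_{1..3}).
Hypotheses (d_gt0 : (0 < d)%N) (w0 : forall j, w j != 0).
Hypothesis mm_inj : injective mm.
Hypothesis mmP : forall m, (exists j, mm j = m) <-> upward d.+1 m /\ T m.
Hypothesis T_down : forall m, downward d.+1 m -> T m.

Let x (j : 'I_N) (v : 'I_3) : K := (mm j v)%:R.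

Lemma fall_nat (m k : nat) : fall m%:R k = (m ^_ k)%:R :> K.
Proof.
elim: k => [|k IHk]; first by rewrite fall0 ffactn0.
rewrite fallS IHk ffactnSr natrM; have [lt_mk|le_km] := ltnP m k.
  by rewrite ffact_small // !mul0r.
by rewrite natrB.
Qed.

(** If [b] does not divide [m], some factor is zero. Otherwise m = x_v b for exactly one [v], and (k
    + 1)_k = (k + 1)!. *)
Lemma prod_fall_top (m b : 'X_{1..3}) : mdeg m = (mdeg b).+1 ->
  \prod_v fall (m v)%:R (b v) =
  (\prod_v (m v)`!)%:R * (\sum_v (m == U_(v) + b)%MM)%:R :> K.
Proof.
move=> dm; under eq_bigr do rewrite fall_nat.
rewrite -natr_prod -natrM; congr _%:R.
have [/existsP[v /eqP Dm]|nex] := boolP [exists v, m == U_(v) + b]%MM; last first.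
  rewrite [X in (_ * X)%N]big1 ?muln0 => [|v _]; last first.
    by apply/eqP; rewrite eqb0; apply: contra nex => mv; apply/existsP; exists v.
  suff [v lt_v] : exists v, (m v < b v)%N by rewrite (bigD1 v) //= ffact_small.
  apply: contrapT => nlt; have le_bm : (b <= m)%MM.
    by apply/mnm_lepP => v; rewrite leqNgt; apply/negP => lt_v; apply: nlt; exists v.
  case/negP: nex; have Dm := submK le_bm; have := congr1 (@mdeg _) Dm.
  rewrite mdegD dm => dmb; have /mdeg1P[v /eqP Dv] : mdeg (m - b)%MM == 1%N.
    by apply/eqP; lia.
  by apply/existsP; exists v; rewrite -Dv Dm.
rewrite [X in (_ * X)%N](bigD1 v) //= Dm eqxx [X in (_ * (_ + X))%N]big1 ?addn0 ?muln1 => [|u neu].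
  apply: eq_bigr => u _; rewrite mnmDE mnm1E.
  case: eqP => _; last by rewrite add0n ffactnn.
  by rewrite add1n -(ffactnn (b u).+1) ffactnSr subSnn muln1.
by rewrite eqm_add2r eq_mnm1 eq_sym (negbTE neu).
Qed.

Lemma dim_fall_span :
  \dim (fall_span w x d.-1) = \rank (@lefschetz_mx K d T (fun=> 1)).
Proof.
pose q := #|{: 'X_{1..3 < d.+1}}|.
pose Z := @lefschetz_mx K d T (fun=> 1).
pose lam j : K := w j * (\prod_v (mm j v)`!)%:R.
have lam0 j : lam j != 0.
  rewrite mulf_neq0 // natr_prod; apply/prodf_neq0 => v _; exact: fact_neq0.
(* [E] selects and rescales the columns belonging to coordinates, and [E'] undoes this. All other
   columns of [Z] are zero, so the rank is kept. *)
pose E : 'M[K]_(q, N) := \matrix_(i, j) ((label i == mm j)%:R * lam j).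
pose E' : 'M[K]_(N, q) := \matrix_(j, i) ((label i == mm j)%:R / lam j).
have deg_mm j : mdeg (mm j) = d.
  by have [+ _] := (mmP (mm j)).1 (ex_intro _ j erefl); rewrite upP => /eqP.
have rowE i : downward d.+1 (label i) -> row i (Z *m E) = fall_row w x (label i).
  move=> di; apply/rowP => j; rewrite !mxE.
  have [uj Tj] := (mmP (mm j)).1 (ex_intro _ j erefl).
  have [l Dl] := up_labelP uj.
  rewrite (bigD1 l) //= [X in _ + X]big1 ?addr0 => [|k nek]; last first.
    rewrite [E k j]mxE -Dl (inj_eq (@label_inj d)) (negbTE nek).
    by rewrite mul0r mulr0.
  rewrite !mxE Dl eqxx mul1r; case: asboolP => [_|[]]; last first.
    by split=> //; exact: T_down.
  rewrite prod_fall_top; last first.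
    by rewrite deg_mm; move: di; rewrite downP => /eqP.
  by rewrite natr_sum /lam mulrC mulrA; congr *%R; apply: eq_bigr => v _; case: eqP.
have row0 i : ~~ downward d.+1 (label i) -> row i (Z *m E) = 0.
  move=> ndi; rewrite row_mul (_ : row i Z = 0) ?mul0mx //.
  by apply/rowP => k; rewrite !mxE; case: asboolP => // -[di]; rewrite di in ndi.
have rankZE : \rank (Z *m E) = \rank Z.
  apply/eqP; rewrite eqn_leq mxrankM_maxl /=.
  suff {1}-> : Z = Z *m E *m E' by exact: mxrankM_maxl.
  rewrite -mulmxA; apply/matrixP => i k; rewrite [RHS]mxE.
  have EE' l : (E *m E') l k = (l == k)%:R * (`[< exists j, mm j = label k >])%:R.
    rewrite mxE; case: asboolP => [[j Dj]|nex]; last first.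
      rewrite mulr0 big1 // => j _; rewrite !mxE; case: (label k =P mm j) => [Dk|].
        by case: nex; exists j.
      by rewrite mul0r mulr0.
    rewrite (bigD1 j) //= !mxE Dj eqxx (inj_eq (@label_inj d)) mul1r mulr1.
    rewrite big1 ?addr0 => [|l' nel]; first by field; exact: lam0.
    by rewrite !mxE -Dj (inj_eq mm_inj) [j == _]eq_sym (negbTE nel) mul0r mulr0.
  rewrite (bigD1 k) //= EE' eqxx mul1r [X in _ + X]big1 ?addr0 => [|l nel]; last first.
    by rewrite EE' (negbTE nel) mul0r mulr0.
  case: asboolP => [_|nex]; first by rewrite mulr1.
  rewrite mulr0 mxE; case: asboolP => // -[_ uk _ Tk]; case: nex.
  exact/mmP.
rewrite -rankZE; apply: dim_rowspace => u; apply/idP/idP; last first.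
  move=> /submxP[y ->]; rewrite mulmx_sum_row; apply: rpred_sum => i _.
  apply: rpredZ; have [di|ndi] := boolP (downward d.+1 (label i)); last first.
    by rewrite row0 ?mem0v.
  rewrite rowE //; apply: fall_row_in.
  by move: di; rewrite downP => /eqP/(congr1 predn) /= ->.
(* For this inclusion rows of degree exactly d - 1 suffice by [fall_span_top]; all of them occur,
   since every downward triangle is in [T]. *)
pose V := <<[seq row i (Z *m E) | i : 'I_q]>>%VS.
have sub_V : (fall_span w x d.-1 <= V)%VS.
  apply: fall_span_top => // [j|a da].
    by rewrite /x -natr_sum -mdegE deg_mm prednK.
  have dn : downward d.+1 a by rewrite downP da prednK.
  have [i Di] := down_labelP dn.
  by rewrite -Di -rowE ?Di //; apply: memv_span; apply/mapP; exists i; rewrite ?mem_enum.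
move/(subvP sub_V) => uV; rewrite -[u]mulmx1.
rewrite (coord_span (X := in_tuple _) uV) mulmx1 summx_sub // => i _.
apply: scalemx_sub; have /mapP[k _ ->] := mem_nth 0 (ltn_ord i).
exact: row_sub.
Qed.

End OsculatingRank.

(** * Generators of the reduced ideal and the Togliatti property *)

Lemma card_mdeg n d j : (j <= d)%N ->
  #|[pred b : 'X_{1..n.+1 < d.+1} | mdeg b == j]| = 'C(j + n, j).
Proof.
move=> le_jd; have := size_basis n j; have := uniq_basis n.+1 j.
have := @basis_cover n.+1 j; move: [seq _ | _ <- _] => L memL uniqL <-.
rewrite cardE -(size_map (@bmnm _ _)); apply/perm_size/uniq_perm => //.
  by rewrite map_inj_uniq ?enum_uniq //; exact: val_inj.
move=> m; rewrite -memL; apply/mapP/idP => [[b + ->]|dm].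
  by rewrite mem_enum.
have dm' : (mdeg m < d.+1)%N by rewrite ltnS (eqP dm).
by exists (BMultinom dm'); rewrite ?mem_enum.
Qed.

Lemma lepm_mdeg_eq n (g m : 'X_{1..n}) : (g <= m)%MM -> mdeg g = mdeg m -> g = m.
Proof.
move=> /submK Dm eqd; have := congr1 (@mdeg _) Dm; rewrite mdegD eqd => h.
have /eqP : mdeg (m - g)%MM = 0%N by lia.
by rewrite mdeg_eq0 => /eqP mg0; rewrite -Dm mg0 add0m.
Qed.

(** The pattern of three monomials, one on each edge of the triangle; for nonnegative entries the
    two terms cannot cancel. *)
Lemma det_cyclic3 (a b c d e f : int) (M : 'M[int]_3) :
    (forall i v : 'I_3, M i v = nth 0 (nth [::]
       [:: [:: a; b; 0]; [:: 0; c; d]; [:: e; 0; f]] i) v) ->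
  \det M = a * c * f + b * d * e.
Proof.
move=> ME; do 2![rewrite !(expand_det_row _ ord0) !big_ord_recl !big_ord0 /cofactor].
rewrite !det_mx11 !mxE !ME /=; ring.
Qed.

Section Main.
Variables (K : fieldType) (charK : [pchar K] =i pred0) (d : nat).
Implicit Types (I : set {mpoly K[3]}) (a : 'I_3 -> K).

Local Notation B := 'X_{1..3 < d.+1}.

Lemma hilbert_num_up I : monomially_spanned I ->
  hilbert I d = num_up d (region d.+1 I).
Proof.
move=> spI; rewrite (hilbertE (d := d) spI) //; apply: eq_card => b.
rewrite !inE -upP; case: (boolP (upward _ _)) => //= ub.
apply/asboolPn/asboolP => [nI|[]//]; by split; rewrite ?ub.
Qed.

Lemma hilbert_num_down I : monomially_spanned I -> (0 < d)%N ->
  hilbert I d.-1 = num_down d (region d.+1 I).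
Proof.
move=> spI d0; rewrite (hilbertE (d := d) spI) ?leq_pred //; apply: eq_card => b.
rewrite !inE; have -> : (mdeg b == d.-1) = downward d.+1 b by rewrite downP; lia.
case: (boolP (downward _ _)) => //= db.
apply/asboolPn/asboolP => [nI|[]//]; by split; rewrite ?db ?orbT.
Qed.

Lemma generic_linear_form (F : {mpoly K[3]}) : F != 0 ->
  exists2 a : 'I_3 -> K, F.@[a] != 0 & forall v, a v != 0.
Proof.
move=> F0; have [a] : exists a, (F * 'X_[[multinom 1%N | i < 3]]).@[a] != 0.
  apply: mpoly_nonvanishing => //; rewrite mulf_neq0 //.
  by rewrite -msupp_eq0 msuppX.
rewrite mevalM mulf_eq0 negb_or => /andP[Fa]; rewrite mevalX => /prodf_neq0 a0.
by exists a => // v; have := a0 v isT; rewrite mnmE.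
Qed.

(** For d = 0 the pure power in [I] is 1, so the quotient is zero and leaves no room for a positive
    defect. *)
Lemma artinian_degree_gt0 I delta : monomial_ideal [set m | (mdeg m <= d)%N] I ->
  artinian I -> (0 < delta)%N -> fails_WLP I d.-1 delta -> (0 < d)%N.
Proof.
move=> mI artI delta0 [F F0 /= failI]; have spI := monomial_ideal_spanned mI.
have [a Fa _] := generic_linear_form F0.
rewrite lt0n; apply/eqP => d0; have := artinian_pure_power ord0 mI _ artI.
move=> /(_ d (fun m h => h)); rewrite d0 mulm0n => I1.
have := failI a Fa; rewrite d0 (hilbertE (d := 0) spI) //.
rewrite [X in minn X](_ : _ = 0%N) ?min0n => [|]; first by lia.
apply: eq_card0 => b; rewrite !inE; apply/negP => /andP[_ /asboolPn]; apply.
apply: spanned_lepm I1 => //; by apply/mnm_lepP => i; rewrite mnm0E.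
Qed.

Lemma mult_rank_generic I a : monomially_spanned I -> (0 < d)%N ->
    (forall v, a v != 0) ->
  mult_rank I (\sum_v a v *: 'X_v) d.-1 =
    \rank (@lefschetz_mx K d (region d.+1 I) (fun=> 1)).
Proof. by move=> spI d0 a0; rewrite -(lefschetz_rank_scale _ _ a0) -mult_rankE. Qed.

(** The rank is constant on the torus, so a general form may be replaced by x + y + z, and the
    complement of xyz = 0 serves as the open set. *)
Lemma fails_WLP_rank I delta : monomially_spanned I -> (0 < d)%N ->
    (num_down d (region d.+1 I) <= num_up d (region d.+1 I))%N ->
  fails_WLP I d.-1 delta <->
  (\rank (@lefschetz_mx K d (region d.+1 I) (fun=> 1%R)) + delta =
     num_down d (region d.+1 I))%N.
Proof.
move=> spI d0 le_du; rewrite /fails_WLP prednK // hilbert_num_up // hilbert_num_down //.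
rewrite (minn_idPl le_du); split=> [[F F0 /= failI]|eq_rank].
  have [a Fa a0] := generic_linear_form F0.
  by rewrite -(failI a Fa) mult_rank_generic.
exists 'X_[[multinom 1%N | i < 3]]; first by rewrite -msupp_eq0 msuppX.
move=> a; rewrite mevalX => /prodf_neq0 a0; rewrite mult_rank_generic // => v.
by have := a0 v isT; rewrite mnmE.
Qed.

Section GeneratedInDegree.
Variable J : set {mpoly K[3]}.
Hypotheses (d_gt0 : (0 < d)%N) (J_mon : monomial_ideal [set m | mdeg m = d] J).
Hypothesis J_artinian : artinian J.

Let spJ : monomially_spanned J := monomial_ideal_spanned J_mon.

Definition degree_gens : pred B := [pred b : B | (mdeg b == d) && `[< J 'X_[b] >]].

Lemma mdeg_geq_of_mem m : J 'X_[m] -> (d <= mdeg m)%N.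
Proof.
have [M MD ->] := monomial_idealP J_mon => /(_ m).
move=> /(_ (introT (mem_msuppXP _ _ _) erefl))[g /MD/= <- /submK <-].
by rewrite mdegD leq_addl.
Qed.

Lemma region_down m : downward d.+1 m -> region d.+1 J m.
Proof.
move=> dm; split; first by rewrite dm orbT.
by move=> /mdeg_geq_of_mem; move: dm; rewrite downP; lia.
Qed.

Lemma num_down_full : num_down d (region d.+1 J) = 'C(d.-1 + 2, d.-1).
Proof.
rewrite -(@card_mdeg 2 d) ?leq_pred //; apply: eq_card => b; rewrite !inE.
have -> : (mdeg b == d.-1) = downward d.+1 b by rewrite downP; lia.
by apply: andb_idr => db; apply/asboolP; exact: region_down.
Qed.

(** There are d + 1 more monomials of degree d than of degree d - 1. So there are at most d + 1
    generators exactly when the downward triangles do not outnumber the upward ones. *)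
Lemma card_gens : (#|degree_gens| + num_up d (region d.+1 J))%N =
  (d.+1 + num_down d (region d.+1 J))%N.
Proof.
rewrite num_down_full; transitivity 'C(d + 2, d).
  rewrite -(@card_mdeg 2 d) // -[RHS](cardID degree_gens); congr (_ + _)%N.
    by apply: eq_card => b; rewrite !inE; case: (mdeg b == d).
  apply: eq_card => b; rewrite !inE upP; case: eqP => //= db; rewrite ?andbF ?andbT //.
  apply/asboolP/asboolPn => [[]//|nJ]; split=> //.
  by rewrite upP db eqxx.
case: d d_gt0 => // k _; by rewrite /= !addn2 binS binSn.
Qed.

Lemma pure_power_in v : J 'X_[(U_(v) *+ d)%MM].
Proof. by apply: (artinian_pure_power v J_mon) => // m /= ->. Qed.

Hypothesis card_le : (#|degree_gens| <= d.+1)%N.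

(* The d - 1 inner monomials of an edge and the three pure powers are d + 2
   monomials, so they cannot all be generators. *)
Lemma edge_monomial (v w u : 'I_3) : v != w -> u != v -> u != w ->
  exists2 m : 'X_{1..3}, [/\ mdeg m = d, (0 < m v)%N, (0 < m w)%N & m u = 0%N] &
    ~ J 'X_[m].
Proof.
move=> ne_vw ne_uv ne_uw; apply: contrapT => nex.
pose g (k : 'I_d.+2) : 'X_{1..3} :=
  if (k <= d)%N then (U_(v) *+ k + U_(w) *+ (d - k))%MM else (U_(u) *+ d)%MM.
have gd k : mdeg (g k) = d.
  by rewrite /g; case: ifP => le_kd; rewrite ?mdegD !mdegMn !mdeg1; lia.
have gv (k : 'I_d.+2) : (k <= d)%N -> g k v = k /\ g k u = 0%N.
  move=> le_kd; rewrite /g le_kd !mnmDE !mulmnE !mnm1E eqxx.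
  rewrite (eq_sym w v) (eq_sym v u) (eq_sym w u).
  by rewrite (negbTE ne_vw) (negbTE ne_uv) (negbTE ne_uw) /=; lia.
have gu (k : 'I_d.+2) : ~~ (k <= d)%N -> g k u = d.
  by move=> nle; rewrite /g (negbTE nle) mulmnE mnm1E eqxx mul1n.
have ltg k : (mdeg (g k) < d.+1)%N by rewrite gd.
pose gB k : B := BMultinom (ltg k).
have gB_inj : injective gB.
  move=> k l /(congr1 (@bmnm _ _)) /= eq_g; apply: val_inj => /=.
  have [lek|nlek] := boolP (k <= d)%N; have [lel|nlel] := boolP (l <= d)%N.
  - by rewrite -(gv k lek).1 eq_g (gv l lel).1.
  - by have := (gv k lek).2; rewrite eq_g (gu l nlel); lia.
  - by have := (gv l lel).2; rewrite -eq_g (gu k nlek); lia.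
  - by have := ltn_ord k; have := ltn_ord l; lia.
have gJ k : J 'X_[g k].
  have [le_kd|nle] := boolP (k <= d)%N; last first.
    by rewrite /g (negbTE nle); exact: pure_power_in.
  have [k0|k0] := posnP (nat_of_ord k).
    by rewrite /g le_kd k0 mulm0n add0m subn0; exact: pure_power_in.
  have [kd|ned] := eqVneq (nat_of_ord k) d.
    by rewrite /g le_kd kd subnn mulm0n addm0; exact: pure_power_in.
  apply: contrapT => nJ; apply: nex; exists (g k) => //.
  rewrite gd (gv k le_kd).1 (gv k le_kd).2; split=> //.
  rewrite /g le_kd mnmDE !mulmnE !mnm1E eqxx (negbTE ne_vw); lia.
have : (d.+2 <= #|degree_gens|)%N.
  rewrite -[X in (X <= _)%N]card_ord -(card_codom gB_inj); apply: subset_leq_card.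
  apply/fintype.subsetP => _ /codomP[k ->]; rewrite inE /= gd eqxx; exact/asboolP/gJ.
by rewrite ltnNge card_le.
Qed.

(** Minimality holds because distinct monomials of equal degree do not divide one another. *)
Lemma togliatti_generators : exists r (f : r.-tuple {mpoly K[3]}),
  [/\ (r <= d.+1)%N, forall i, tnth f i \is d.-homog & minimally_generated_by f J].
Proof.
have genP (i : 'I_#|degree_gens|) : mdeg (bmnm (enum_val i)) = d /\ J 'X_[bmnm (enum_val i)].
  by have /andP[/eqP ? /asboolP] := enum_valP i.
exists #|degree_gens|, [tuple 'X_[bmnm (enum_val i)] | i < #|degree_gens|]; split=> // [i|].
  by rewrite tnth_mktuple dhomogX /=; apply/eqP; case: (genP i).
split=> [|i].
  apply/seteqP; split; last first.
    apply: ideal_gen_sub; first exact: (proj1 spJ).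
    by move=> _ /= /mapP[i _ ->]; case: (genP i).
  case: J_mon => M MD DJ; rewrite {1}DJ; apply: ideal_gen_sub; first exact: ideal_genP.
  move=> _ [m Mm <-]; apply: sub_ideal_gen => /=.
  have dm : mdeg m = d := MD _ Mm.
  have ltm : (mdeg m < d.+1)%N by rewrite dm.
  have mg : (BMultinom ltm : B) \in degree_gens.
    rewrite inE /= dm eqxx; apply/asboolP; rewrite DJ.
    by apply: sub_ideal_gen; exists m.
  by apply/mapP; exists (enum_rank_in mg (BMultinom ltm)); rewrite ?mem_enum ?enum_rankK_in.
pose L := [set m | exists2 k : 'I_#|degree_gens|, k != i & m = bmnm (enum_val k)].
have -> : [set tnth [tuple 'X_[K, bmnm (enum_val i)] | i < #|degree_gens|] k
    | k in [set k | k != i]] = [set 'X_[K, m] | m in L].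
  apply/seteqP; split=> [_ [k /= ne_ki <-]|_ [_ [k ne_ki ->] <-]].
    by exists (bmnm (enum_val k)); [exists k | rewrite tnth_mktuple].
  by exists k => //; rewrite tnth_mktuple.
rewrite ideal_gen_monomialsE tnth_mktuple.
move=> /(_ _ (introT (mem_msuppXP _ _ _) erefl))[_ [k ne_ki ->] le_ki].
case/eqP: ne_ki; apply/enum_val_inj/val_inj/lepm_mdeg_eq => //=.
by rewrite (genP k).1 (genP i).1.
Qed.

End GeneratedInDegree.
End Main.

(** * Laplace equations of the inverse system variety *)

Section ToricLaplace.
Variables (K : fieldType) (charK : [pchar K] =i pred0).
Variables (N d : nat) (mm : 'I_N -> 'X_{1..3}) (f : N.-tuple {mpoly K[3]}).
Variable T : set 'X_{1..3}.
Hypothesis d_gt0 : (0 < d)%N.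
Hypothesis fE : forall j, tnth f j = 'X_[mm j].
Hypothesis mm_inj : injective mm.
Hypothesis mmP : forall m, (exists j, mm j = m) <-> upward d.+1 m /\ T m.
Hypothesis T_down : forall m, downward d.+1 m -> T m.
Variable base : 'I_3 -> 'I_N.
Hypothesis base_det :
  \det (\matrix_(i < 3, v < 3) (mm (base i) v)%:Z : 'M[int]_3) != 0.

(** The derivatives involve two exponent differences, the matrix three exponents. Each family is
    affine in the other, the third exponent being recovered from the sum [d]. *)
Lemma osculating_rank P c : (forall j, P j != 0) ->
  \dim (<<[seq fps_deriv (torus_param mm P c) (bmnm a) | a : 'X_{1..2 < d.-1.+1}]>>%VS
        : {vspace 'rV[K]_N})
    = \rank (@lefschetz_mx K d T (fun=> 1)).
Proof.
move=> P0; pose w j := P j / P c; pose y := rel_exponent K mm c.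
pose x (j : 'I_N) (v : 'I_3) : K := (mm j v)%:R.
have w0 j : w j != 0 by rewrite mulf_neq0 ?invr_eq0.
have deg_mm j : mdeg (mm j) = d.
  by have [+ _] := (mmP (mm j)).1 (ex_intro _ j erefl); rewrite upP => /eqP.
rewrite -(dim_fall_span charK d_gt0 w0 mm_inj mmP T_down) -/x.
have -> : [seq fps_deriv (torus_param mm P c) (bmnm a) | a : 'X_{1..2 < d.-1.+1}] =
    [seq fall_row w y (bmnm a) | a : 'X_{1..2 < d.-1.+1}].
  by apply: eq_map => a; rewrite fps_deriv_torus.
rewrite -/(fall_span w y d.-1); apply: (congr1 (fun V : {vspace 'rV[K]_N} => \dim V)).
apply: subv_anti.
apply/andP; split; apply: fall_span_change => i.
  exists (- x c (coord i)), (fun v => (v == coord i)%:R) => j.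
  rewrite (bigD1 (coord i)) //= eqxx mul1r big1 ?addr0; first by rewrite addrC.
  by move=> v /negbTE->; rewrite mul0r.
have -> : i = if unlift ord_max i is Some l then coord l else ord_max.
  case: unliftP => [l ->|//]; apply: val_inj; exact: lift_max.
case: (unlift _ _) => [l|].
  exists (x c (coord l)), (fun v => (v == l)%:R) => j.
  rewrite (bigD1 l) //= eqxx mul1r big1 ?addr0 => [|v /negbTE->].
    by rewrite /y /rel_exponent addrC subrK.
  by rewrite mul0r.
exists (d%:R - \sum_l x c (coord l)), (fun=> -1) => j.
have : \sum_v x j v = d%:R by rewrite /x -natr_sum -mdegE deg_mm.
rewrite sum_coord => <-.
have -> : \sum_l -1 * y j l = \sum_l x c (coord l) - \sum_l x j (coord l).
  by rewrite -sumrB; apply: eq_bigr => l _; rewrite mulN1r opprB.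
by ring.
Qed.

Lemma laplace_toric delta :
    (\rank (@lefschetz_mx K d T (fun=> 1%R)) + delta)%N = 'C(2 + d.-1, d.-1) ->
  laplace_equations (image_closure f) d.-1 delta.
Proof.
move=> eq_rank; exists 2%N.
  apply: (proj_dim2 charK d_gt0 _ fE base_det) => j.
  by have [+ _] := (mmP (mm j)).1 (ex_intro _ j erefl); rewrite upP => /eqP.
have evG P : ('X_[[multinom 1%N | j < N]] : {mpoly K[N]}).@[P] = \prod_j P j.
  by rewrite mevalX; apply: eq_bigr => j _; rewrite mnmE.
(* The points taken as general are those with all coordinates nonzero. *)
exists 'X_[[multinom 1%N | j < N]]; split.
- by exists (mdeg [multinom 1%N | j < N]); rewrite dhomogX.
- exists (fun=> 1); first exact: (image_closure_ones fE base).
  by rewrite evG big1 // oner_neq0.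
move=> P XP; rewrite evG => /prodf_neq0 P0'.
have P0 j : P j != 0 := P0' j isT.
have deg_mm j : mdeg (mm j) = d.
  by have [+ _] := (mmP (mm j)).1 (ex_intro _ j erefl); rewrite upP => /eqP.
split; first exact: (smooth_point_torus charK d_gt0 deg_mm fE base_det).
pose c := base ord0.
pose V : {vspace 'rV[K]_N} :=
  <<[seq fps_deriv (torus_param mm P c) (bmnm a) | a : 'X_{1..2 < d.-1.+1}]>>%VS.
have dimV : \dim V = \rank (@lefschetz_mx K d T (fun=> 1)) by exact: osculating_rank.
(* The projective dimension is the predecessor of [\dim V], untruncated because the derivative of
   order 0 has entry 1 at [c]. *)
have V0 : (0 < \dim V)%N.
  rewrite lt0n dimv_eq0; apply/eqP => eqV0.
  have : fps_deriv (torus_param mm P c) (bmnm (bm0 : 'X_{1..2 < d.-1.+1})) \in V.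
    by apply: memv_span; apply/mapP; exists bm0; rewrite ?mem_enum.
  rewrite eqV0 memv0 fps_deriv_torus // => /eqP/rowP/(_ c); rewrite !mxE big1.
    by rewrite mulr1 divff // => /eqP; rewrite oner_eq0.
  by move=> i _; rewrite mnm0E fall0.
exists (\dim V).-1; last by rewrite addn1 prednK // dimV.
exists (torus_param mm P c); last by rewrite (prednK V0).
exact: (local_param_torus charK d_gt0 deg_mm fE base_det).
Qed.

End ToricLaplace.

Lemma inverse_system_laplace (K : fieldType) (charK : [pchar K] =i pred0) d
    (J : set {mpoly K[3]}) delta : (0 < d)%N ->
    monomial_ideal [set m | mdeg m = d] J -> artinian J ->
    (#|@degree_gens K d J| <= d.+1)%N ->
    (\rank (@lefschetz_mx K d (region d.+1 J) (fun=> 1%R)) + delta)%N =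
      'C(2 + d.-1, d.-1) ->
  laplace_equations (inverse_system_variety J d) d.-1 delta.
Proof.
move=> d0 J_mon J_art card_le eq_rank.
rewrite /inverse_system_variety.
pose s := [seq m <- enum {: 'X_{1..3 < d.+1}}
  | (mdeg (bmnm m) == d) && ~~ `[< J 'X_[bmnm m] >]].
have S_E : inverse_system_monomials J d = [seq 'X_[bmnm m] | m <- s] by [].
set S := inverse_system_monomials J d in S_E *.
have size_S : size S = size s by rewrite S_E size_map.
pose mm (j : 'I_(size S)) : 'X_{1..3} := bmnm (nth bm0 s j).
have fE j : tnth (in_tuple S) j = 'X_[mm j].
  by rewrite (tnth_nth 0) /= {1}S_E (nth_map bm0) // -size_S.
have s_uniq : uniq s by rewrite filter_uniq ?enum_uniq.
have mm_inj : injective mm.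
  move=> i j /val_inj/eqP; rewrite nth_uniq -?size_S // => /eqP; exact: val_inj.
have mmP m : (exists j, mm j = m) <-> upward d.+1 m /\ region d.+1 J m.
  split=> [[j <-]|[um [_ nJ]]].
    have : nth bm0 s j \in s by rewrite mem_nth // -size_S.
    rewrite mem_filter => /andP[/andP[dm /asboolPn nJ] _].
    by rewrite /region /= upP /mm dm.
  have dm : (mdeg m < d.+1)%N by move: um; rewrite upP => /eqP->.
  have ms : BMultinom dm \in s.
    by rewrite mem_filter mem_enum /= -upP um andbT; apply/asboolPn.
  have lt_i : (index (BMultinom dm) s < size S)%N by rewrite size_S index_mem.
  by exists (Ordinal lt_i); rewrite /mm /= nth_index.
have T_down := region_down d0 J_mon.
have in_image m : mdeg m = d -> ~ J 'X_[m] -> exists j, mm j = m.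
  by move=> dm nJ; apply/mmP; rewrite /region /= upP dm eqxx.
pose o1 : 'I_3 := @Ordinal 3 1 isT.
(* One monomial inside each edge lies outside [J]. Of the two terms of the determinant of their
   exponents, the first is positive and the second nonnegative. *)
have [m0 [dm0 a0 b0 z0] /(in_image _ dm0)[j0 Dj0]] :=
  edge_monomial d0 J_mon J_art card_le (v := ord0) (w := o1) (u := ord_max) isT isT isT.
have [m1 [dm1 a1 b1 z1] /(in_image _ dm1)[j1 Dj1]] :=
  edge_monomial d0 J_mon J_art card_le (v := o1) (w := ord_max) (u := ord0) isT isT isT.
have [m2 [dm2 a2 b2 z2] /(in_image _ dm2)[j2 Dj2]] :=
  edge_monomial d0 J_mon J_art card_le (v := ord0) (w := ord_max) (u := o1) isT isT isT.
pose base (i : 'I_3) := nth j0 [:: j0; j1; j2] i.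
apply: (laplace_toric charK d0 fE mm_inj mmP T_down (base := base)) => //.
rewrite (det_cyclic3 (a := (m0 ord0)%:Z) (b := (m0 o1)%:Z) (c := (m1 o1)%:Z)
  (d := (m1 ord_max)%:Z) (e := (m2 ord0)%:Z) (f := (m2 ord_max)%:Z)).
  by rewrite -!PoszM -PoszD eqz_nat -lt0n addn_gt0 !muln_gt0 a0 a1 b2.
move=> i v; rewrite mxE /base.
have Dv (k : nat) (lt_k : (k < 3)%N) (o : 'I_3) : o = k :> nat -> Ordinal lt_k = o.
  by move=> eqo; apply: val_inj.
by case: i v => [[|[|[|//]]] ?] [[|[|[|//]]] ?] /=; rewrite ?Dj0 ?Dj1 ?Dj2;
  rewrite ?(Dv 0 _ ord0) ?(Dv 1 _ o1) ?(Dv 2 _ ord_max) ?z0 ?z1 ?z2.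
Qed.

Theorem theorem11p10 (K : closedFieldType) (charK : [pchar K] =i pred0)
    (d : nat)
    (I : set {mpoly K[3]})
    (I_monomial : monomial_ideal [set m | (mdeg m <= d)%N] I)
    (I_artinian : artinian I)
    (hilbert_le : (hilbert I d.-1 <= hilbert I d)%N)
    (delta : nat) (delta_gt0 : (0 < delta)%N)
    (I_fails : fails_WLP I d.-1 delta)
    (That : set 'X_{1..3})
    (That_reduction :
       reduction_to_unit_punctures K d.+1 (region d.+1 I) That)
    (Ihat : set {mpoly K[3]})
    (Ihat_monomial : monomial_ideal [set m | mdeg m = d] Ihat)
    (That_Ihat : That = region d.+1 Ihat)
    (Ihat_artinian : artinian Ihat) :
  togliatti d Ihat /\
  laplace_equations (inverse_system_variety Ihat d) d.-1 delta.
Proof.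
have d0 := artinian_degree_gt0 charK I_monomial I_artinian delta_gt0 I_fails.
have spI := monomial_ideal_spanned I_monomial.
have spIhat := monomial_ideal_spanned Ihat_monomial.
move: hilbert_le; rewrite (hilbert_num_down spI d0) (hilbert_num_up d spI) => le_I.
have rank_I := (fails_WLP_rank charK delta spI d0 le_I).1 I_fails.
have [k [eq_down eq_up eq_rank]] :=
  pivot_ext_invariants (fun=> oner_neq0 K) (reduction_pivot That_reduction).
rewrite That_Ihat in eq_down eq_up eq_rank.
have le_Ihat : (num_down d (region d.+1 Ihat) <= num_up d (region d.+1 Ihat))%N.
  by rewrite eq_down eq_up leq_add2r.
have rank_Ihat : (\rank (@lefschetz_mx K d (region d.+1 Ihat) (fun=> 1%R)) + delta)%N
    = num_down d (region d.+1 Ihat).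
  by rewrite eq_rank eq_down -rank_I addnAC.
(* [card_gens] turns the preserved inequality into the bound on the number of generators. *)
have card_le : (#|@degree_gens K d Ihat| <= d.+1)%N.
  by have := card_gens d0 Ihat_monomial; lia.
split; last first.
  apply: inverse_system_laplace => //.
  by rewrite rank_Ihat num_down_full // addnC.
split=> //; first exact: togliatti_generators.
by exists delta => //; apply/fails_WLP_rank.
Qed.
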